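(* Let $(X,\mathbb{R})$ be a topological flow with the small flow boundary property (SFBP), and fix $\tau\in\mathbb{R}$. Then: (1) For every $\delta>0$ and any two distinct points $w,w'\in X$ there exist a t.d.s. $(Y,T)$ and a factor map $\pi:(X,\tau)\to(Y,T)$ such that $\pi(w)\neq\pi(w')$ and $h_{\mathbb{R}}(\pi)<\delta$. (2) There exists a compatible system of factor maps $\pi_n:(X,\tau)\to(W_n,T_n)$, $n\in\mathbb{N}$, such that $h_{\mathbb{R}}(\pi_n)<\infty$ for all $n$ and $(X,\tau)=\varprojlim(W_n,T_n)$. That is, there are t.d.s. $(W_n,T_n)$, factor maps $\pi_n:(X,\tau)\to(W_n,T_n)$ with $h_{\mathbb{R}}(\pi_n)<\infty$, and factor maps $q_n:(W_{n+1},T_{n+1})\to(W_n,T_n)$ with $\pi_n=q_n\circ\pi_{n+1}$ for all $n$, such that $x\mapsto(\pi_n(x))_{n}$ is an isomorphism of t.d.s. from $(X,\tau)$ onto the inverse limit $\varprojlim(W_n,T_n)$.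
   Context: A topological flow $(X,\mathbb{R})$ is a compact metrizable space $X$ with a continuous action $(t,x)\mapsto tx$ of $\mathbb{R}$. It is fixed-point free if no $x\in X$ satisfies $tx=x$ for all $t\in\mathbb{R}$. A t.d.s. $(Y,T)$ is a compact metrizable space with a homeomorphism $T$. For $\tau\in\mathbb{R}$, $(X,\tau)$ denotes the t.d.s. generated by the homeomorphism $x\mapsto\tau x$. A factor map $(X,T)\to(Y,S)$ is a continuous surjection intertwining $T$ and $S$. Given factor maps $q_n:(W_{n+1},T_{n+1})\to(W_n,T_n)$, the inverse limit $\varprojlim(W_n,T_n)$ is $\{(w_n)_n\in\prod_nW_n: q_n(w_{n+1})=w_n\ \forall n\}$ with the product topology and the coordinatewise action. Flow-generated entropy: for a factor map $\pi:(X,\tau)\to(Y,S)$, $h_{\mathbb{R}}(\pi):=\sup_{\mu\in P_{\mathbb{R}}(X)}h_{\pi_*\mu}(S)$, where $P_{\mathbb{R}}(X)$ is the set of $\mathbb{R}$-invariant Borel probability measures on $X$ and $h_\nu(S)$ is Kolmogorov–Sinai entropy. SFBP: for $A\subset X$ and $s<s'$ write $[s,s']A=\{ta:t\in[s,s'],a\in A\}$. A cross-section with injectivity time $\eta>0$ is a set $S\subset X$ such that $[-\eta,\eta]\times S\to X$, $(t,x)\mapsto tx$, is injective. For a subset $U$ of a closed cross-section with injectivity time $\eta$, the flow interior is $\mathrm{Int}^{\mathbb{R}}U:=\mathrm{Int}([-\eta,\eta]U)\cap U$ (interior in $X$) and the flow boundary is $\partial^{\mathbb{R}}U:=\overline U\setminus\mathrm{Int}^{\mathbb{R}}U$.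 A set is null if it has measure zero for every $\mathbb{R}$-invariant Borel probability measure on $X$. A closed cross-section $S$ with injectivity time $\eta$ has a small flow boundary if $[-\eta,\eta](\partial^{\mathbb{R}}S)$ is null. The flow has SFBP if it is fixed-point free and for each $x\in X$ and each closed cross-section $S'$ with $x\in\mathrm{Int}^{\mathbb{R}}(S')$ there is a closed subset $S\subset S'$ such that $x\in\mathrm{Int}^{\mathbb{R}}(S)$ and $S$ has a small flow boundary. *)

(* Defs.v *)
From HB Require Import structures.
From mathcomp Require Import all_boot all_order all_algebra.
From mathcomp Require Import all_classical all_reals all_analysis.

Set Implicit Arguments.
Unset Strict Implicit.
Unset Printing Implicit Defensive.

Import Order.TTheory GRing.Theory Num.Theory.
Import numFieldNormedType.Exports.

Local Open Scope classical_set_scope.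
Local Open Scope ring_scope.

Definition metrizable (R : realType) (T : topologicalType) : Prop :=
  exists d : T -> T -> R,
    [/\ forall x y, d x y = 0 <-> x = y,
        forall x y, d x y = d y x,
        forall x y z, d x z <= d x y + d y z
      & forall (x : T) (A : set T),
          nbhs x A <-> exists2 e : R, 0 < e & [set y | d x y < e] `<=` A].

Definition homeomorphism (T U : topologicalType) (f : T -> U) : Prop :=
  continuous f /\ exists g : U -> T, [/\ continuous g, cancel f g & cancel g f].

(* Phase spaces are pointed, i.e. nonempty: the Borel measurable structure is
   only available on pointed types, and invariant probability measures only
   exist on nonempty spaces. The point itself plays no role. *)
Record tds (R : realType) := TDS {
  tds_space :> ptopologicalType;
  tds_map : tds_space -> tds_space;
  tds_compact : compact [set: tds_space];
  tds_metrizable : metrizable R tds_space;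
  tds_homeo : homeomorphism tds_map }.

Record topological_flow (R : realType) := TopologicalFlow {
  flow_space :> ptopologicalType;
  flow : R -> flow_space -> flow_space;
  flow_compact : compact [set: flow_space];
  flow_metrizable : metrizable R flow_space;
  flow_continuous : continuous (fun p : R * flow_space => flow p.1 p.2);
  flow0 : forall x, flow 0 x = x;
  flowD : forall s t x, flow (s + t) x = flow s (flow t x) }.

Arguments tds_map {R} _ _.
Arguments flow {R} _ _ _.

Lemma flow_homeo (R : realType) (X : topological_flow R) (tau : R) :
  homeomorphism (flow X tau).
Proof.
have cts t : continuous (flow X t).
  move=> x.
  have pc : (fun y : X => (t, y)) @ x --> (t, x).
    exact: (cvg_pair (cvg_cst t) cvg_id).
  exact: (cvg_comp _ _ pc (@flow_continuous R X (t, x))).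
split; first exact: cts.
exists (flow X (- tau)); split; first exact: cts.
- by move=> x; rewrite -flowD addNr flow0.
- by move=> x; rewrite -flowD addrN flow0.
Qed.

Definition flow_tds (R : realType) (X : topological_flow R) (tau : R) : tds R :=
  TDS (@flow_compact R X) (flow_metrizable X) (flow_homeo X tau).

Definition factor_map (R : realType) (A B : tds R) (f : A -> B) : Prop :=
  [/\ continuous f, f @` setT = setT
    & forall x, f (tds_map A x) = tds_map B (f x)].

Definition inverse_limit (R : realType) (W : nat -> tds R)
    (q : forall n, W n.+1 -> W n) :
    set (prod_topology (fun n => W n : topologicalType)) :=
  [set w | forall n, q n (w n.+1) = w n].

(* The inverse limit carries the subspace topology of the product and the
   coordinatewise action. *)
Definition isomorphism_onto_inverse_limit (R : realType) (A : tds R)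
    (W : nat -> tds R) (q : forall n, W n.+1 -> W n)
    (F : A -> prod_topology (fun n => W n : topologicalType)) : Prop :=
  [/\ continuous F,
      F @` setT = inverse_limit q,
      exists2 G : prod_topology (fun n => W n : topologicalType) -> A,
        {within inverse_limit q, continuous G} & cancel F G
    & forall x, F (tds_map A x) = (fun n => tds_map (W n) (F x n))].

Definition borel (T : ptopologicalType) := g_sigma_algebraType (@open T).

Section KolmogorovSinai.
Context {R : realType} {Y : ptopologicalType}.
Implicit Types (nu : set (borel Y) -> \bar R) (S : Y -> Y).

(* A finite Borel partition is encoded by its labelling function
   [xi : Y -> I]; its cells are the fibres of [xi], possibly empty. *)
Definition borel_partition (I : finType) (xi : Y -> I) : Prop :=
  forall i, measurable (xi @^-1` [set i] : set (borel Y)).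

Definition static_entropy nu (I : finType) (xi : Y -> I) : R :=
  - \sum_(i : I) (fine (nu (xi @^-1` [set i])) *
                  ln (fine (nu (xi @^-1` [set i])))).

(* Labelling function of the join of the partitions [S^-j xi], [j < n]. *)
Definition itinerary S (I : finType) (xi : Y -> I) (n : nat) (y : Y) :
    {ffun 'I_n -> I} :=
  [ffun j : 'I_n => xi (iter j S y)].

Definition partition_entropy nu S (I : finType) (xi : Y -> I) : \bar R :=
  limn (fun n => (static_entropy nu (itinerary S xi n.+1) / n.+1%:R)%:E).

Definition ks_entropy nu S : \bar R :=
  ereal_sup [set h | exists (k : nat) (xi : Y -> 'I_k),
    borel_partition xi /\ h = partition_entropy nu S xi].

End KolmogorovSinai.

Section Flows.
Context {R : realType} (X : topological_flow R).

Definition invariant_measure (mu : probability (borel X) R) : Prop :=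
  forall (t : R) (A : set (borel X)),
    measurable A -> mu (flow X t @^-1` A) = mu A.

Definition flow_entropy (Y : tds R) (pi : X -> Y) : \bar R :=
  ereal_sup [set ks_entropy
      (pushforward mu (pi : borel X -> borel Y)) (tds_map Y) |
    mu in [set mu : probability (borel X) R | invariant_measure mu]].

Definition flow_null (A : set X) : Prop :=
  forall mu : probability (borel X) R,
    invariant_measure mu -> mu.-negligible (A : set (borel X)).

Definition fixed_point_free : Prop :=
  forall x : X, ~ forall t : R, flow X t x = x.

Definition sweep (s s' : R) (A : set X) : set X :=
  [set flow X t a | t in [set` `[s, s']] & a in A].

Definition cross_section (eta : R) (S : set X) : Prop :=
  0 < eta /\
  set_inj ([set` `[- eta, eta]] `*` S) (fun p : R * X => flow X p.1 p.2).

Definition flow_interior (eta : R) (U : set X) : set X :=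
  interior (sweep (- eta) eta U) `&` U.

Definition flow_boundary (eta : R) (U : set X) : set X :=
  closure U `\` flow_interior eta U.

Definition small_flow_boundary (eta : R) (S : set X) : Prop :=
  flow_null (sweep (- eta) eta (flow_boundary eta S)).

(* A subset of a cross-section with injectivity time [eta] is again one, and
   the flow interior and boundary of a subset of a closed cross-section do not
   depend on the injectivity time, so the same [eta] serves [S'] and [S]. *)
Definition SFBP : Prop :=
  fixed_point_free /\
  forall (x : X) (eta : R) (S' : set X),
    closed S' -> cross_section eta S' -> flow_interior eta S' x ->
    exists S : set X,
      [/\ closed S, S `<=` S', flow_interior eta S x
        & small_flow_boundary eta S].

End Flows.

(* Main.v *)
(* Near a non-fixed point [w] there is a continuous clock [G] with [G (flow s
   x) = G x + s], and a continuous [chi >= 0] vanishing only at [w] and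
   1-Lipschitz along the flow. The bump [u = max 0 (eta - |G - G w| - chi / 2)]
   is monotone in time with slope at least 1/2 on each side of [G = G w], so
   short level bands [p < u <= p + lam] have many disjoint translates and are
   uniformly small for all invariant measures. Composing with a devil's
   staircase adapted to [u] gives a continuous [f : X -> [0, 1]] that is 1 off
   a uniformly small set and takes dyadic values of level [n] off a set of
   measure at most [e n], for any prescribed [e n > 0]. Its countable partition
   into values therefore has arbitrarily small entropy, uniformly in the
   invariant measure, and this bounds the entropy of the factor generated by
   the samples [f (flow (k * tau) x)]. Finitely many such [f] generate a factor
   of finite entropy, and a countable separating family exhibits [X] as an
   inverse limit of these. *)

Require Import Defs.
From HB Require Import structures.
From mathcomp Require Import all_boot all_order all_algebra.
From mathcomp Require Import all_classical all_reals all_analysis.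
From mathcomp Require Import lra ring zify.

Import Order.TTheory GRing.Theory Num.Theory.
Import numFieldNormedType.Exports.

Local Open Scope classical_set_scope.
Local Open Scope ring_scope.

Set Implicit Arguments.
Unset Strict Implicit.

(** The entropy of a factor has to be bounded for all invariant measures at once, while a continuous
    function separating two points may take a continuum of values. The source of uniformity is a
    count: [N] pairwise disjoint translates of a set force its measure below [1 / N], whatever the
    invariant measure. The clock obeys its relation only near [w]; the term in [chi] confines the
    bump to that neighbourhood, and its factor 1/2 is what leaves a positive slope in time. Rounding
    is done by monotone maps because these keep open bands thin, so that a rounded function can be
    rounded again at the next level; each round fixes the dyadic points reached before, so what is
    gained persists in the limit. On the entropy side, a point that has reached a dyadic value of
    low level has trivial digits from then on, and the threshold [e n] is chosen after the alphabet
    of the [n]-th digit, so that the costs of the digits form a geometric series and the bound is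
    the same for codes of every length. *)

(** * Measurability of finite labellings *)

Lemma set_mem_cons (Y : Type) (I : eqType) (xi : Y -> I) (i : I) (r : seq I) :
  [set x | xi x \in i :: r] = (xi @^-1` [set i]) `|` [set x | xi x \in r].
Proof.
apply/seteqP; split=> x /=; rewrite inE.
  by case/orP=> [/eqP|]; [left|right].
by case=> [/eqP->//|->]; rewrite orbT.
Qed.

Lemma measurable_mem (Y : ptopologicalType) (I : finType) (xi : Y -> I) (r : seq I) :
  borel_partition xi -> measurable ([set x | xi x \in r] : set (borel Y)).
Proof.
move=> mxi; elim: r => [|i r IH].
  by rewrite (_ : [set x | _] = set0)//; apply/seteqP; split.
by rewrite set_mem_cons; apply: measurableU => //; exact: mxi.
Qed.

Section Determined.
Context {Y : ptopologicalType} {I J : finType} (xi : Y -> I) (zeta : Y -> J).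
Hypotheses (mxi : borel_partition xi)
  (det : forall x y, xi x = xi y -> zeta x = zeta y).

Lemma measurable_determined (A : set Y) :
  (forall x y, xi x = xi y -> A x -> A y) -> measurable (A : set (borel Y)).
Proof.
move=> Adet.
have -> : A = [set x | xi x \in enum [pred i | `[< exists2 x, A x & xi x = i >]]].
  apply/seteqP; split=> x /=; rewrite mem_enum unfold_in.
    by move=> Ax; apply/asboolP; exists x.
  by move=> /asboolP[y Ay yx]; apply: Adet Ay.
by apply: measurable_mem.
Qed.

Lemma borel_partition_determined : borel_partition zeta.
Proof. by move=> j; apply: measurable_determined => x y /det /= ->. Qed.

Lemma determinedP : exists phi : I -> J, zeta = phi \o xi.
Proof.
have [phi phiP] : exists phi : I -> J, forall x, zeta x = phi (xi x).
  suff /choice[phi phiP] : forall i, exists j, forall x, xi x = i -> zeta x = j.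
    by exists phi => x; exact: phiP.
  move=> i; have [[x <-]|nx] := pselect (exists x, xi x = i).
    by exists (zeta x) => y yx; exact: det.
  by exists (zeta point) => x xi_x; case: nx; exists x.
by exists phi; apply/funext.
Qed.

End Determined.

Lemma borel_partition_ffun (Y : ptopologicalType) (I J : finType) (xi : I -> Y -> J) :
  (forall i, borel_partition (xi i)) ->
  borel_partition (fun x => [ffun i => xi i x] : {ffun I -> J}).
Proof.
move=> mxi h; rewrite (_ : _ @^-1` _ = \bigcap_(i in setT) (xi i @^-1` [set h i])).
  by apply: fin_bigcap_measurable => // i _; exact: mxi.
apply/seteqP; split=> x /=; first by move=> <- i _ /=; rewrite ffunE.
by move=> xh; apply/ffunP => i; rewrite ffunE; exact: xh.
Qed.

(** * Entropy of finite partitions *)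

Section Entropy.
Context {R : realType} {Y : ptopologicalType} (mu : probability (borel Y) R).

Definition prob (A : set Y) : R := fine (mu A).

Lemma probE (A : set (borel Y)) : measurable A -> mu A = (prob A)%:E.
Proof. by move=> mA; rewrite /prob fineK// fin_num_measure. Qed.

Lemma prob_ge0 (A : set Y) : 0 <= prob A.
Proof. by rewrite fine_ge0. Qed.

Lemma probT : prob setT = 1.
Proof. by rewrite /prob probability_setT. Qed.

Lemma prob0 : prob set0 = 0.
Proof. by rewrite /prob measure0. Qed.

Lemma le_prob (A B : set (borel Y)) :
  measurable A -> measurable B -> A `<=` B -> prob A <= prob B.
Proof.
by move=> mA mB AB; rewrite -lee_fin -!probE// le_measure// inE.
Qed.

Lemma probU (A B : set (borel Y)) : measurable A -> measurable B ->
  A `&` B = set0 -> prob (A `|` B) = prob A + prob B.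
Proof.
move=> mA mB AB; apply/EFin_inj; rewrite EFinD -!probE//; last exact: measurableU.
by rewrite measureU.
Qed.

Lemma le_probU (A B : set (borel Y)) : measurable A -> measurable B ->
  prob (A `|` B) <= prob A + prob B.
Proof.
move=> mA mB; rewrite -lee_fin EFinD -!probE//; last exact: measurableU.
by apply: measureU2.
Qed.

Lemma le_prob_bigcup (I : Type) (r : seq I) (F : I -> set (borel Y)) :
  (forall i, measurable (F i)) ->
  prob (\big[setU/set0]_(i <- r) F i) <= \sum_(i <- r) prob (F i).
Proof.
move=> mF; elim: r => [|i r IH]; first by rewrite !big_nil prob0.
rewrite !big_cons (le_trans (le_probU _ _))//; first exact: bigsetU_measurable.
by rewrite lerD2l.
Qed.

Lemma prob_mem (I : finType) (xi : Y -> I) (r : seq I) :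
  borel_partition xi -> uniq r ->
  prob [set x | xi x \in r] = \sum_(i <- r) prob (xi @^-1` [set i]).
Proof.
move=> mxi; elim: r => [_|i r IH /= /andP[ir ur]].
  by rewrite big_nil (_ : [set x | _] = set0) ?prob0//; apply/seteqP; split.
rewrite set_mem_cons big_cons -IH// probU//; first exact: measurable_mem.
by apply/seteqP; split=> x //= -[-> xr]; rewrite xr in ir.
Qed.


Lemma prob_le1 (A : set (borel Y)) : measurable A -> prob A <= 1.
Proof. by move=> mA; rewrite -lee_fin -probE// probability_le1. Qed.

Lemma sum_prob (I : finType) (xi : Y -> I) :
  borel_partition xi -> \sum_i prob (xi @^-1` [set i]) = 1.
Proof.
move=> mxi; rewrite -(prob_mem mxi) ?index_enum_uniq//= -probT.
by congr prob; apply/seteqP; split=> x //= _; rewrite mem_index_enum.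
Qed.

Lemma static_entropyE (I : finType) (xi : Y -> I) : static_entropy mu xi =
  \sum_i - (prob (xi @^-1` [set i]) * ln (prob (xi @^-1` [set i]))).
Proof. by rewrite /static_entropy -sumrN. Qed.

Lemma static_entropy_ge0 (I : finType) (xi : Y -> I) :
  borel_partition xi -> 0 <= static_entropy mu xi.
Proof.
move=> mxi; rewrite static_entropyE sumr_ge0// => i _; rewrite oppr_ge0.
by rewrite mulr_ge0_le0 ?prob_ge0// ln_le0// prob_le1//; exact: mxi.
Qed.


Lemma prob_comp (I J : finType) (xi : Y -> I) (phi : I -> J) (j : J) :
  borel_partition xi -> prob ((phi \o xi) @^-1` [set j]) =
  \sum_(i | phi i == j) prob (xi @^-1` [set i]).
Proof.
move=> mxi; rewrite -big_filter -(prob_mem mxi) ?filter_uniq ?index_enum_uniq//.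
congr prob; apply/seteqP; split=> x /=; rewrite mem_filter mem_index_enum andbT.
  by move=> ->.
by move/eqP.
Qed.

(** A cell of [zeta] is a union of cells of [xi], hence at least as likely as each of them, and
    [- ln] decreases. *)
Lemma static_entropy_le (I J : finType) (xi : Y -> I) (zeta : Y -> J) :
  borel_partition xi -> (forall x y, xi x = xi y -> zeta x = zeta y) ->
  static_entropy mu zeta <= static_entropy mu xi.
Proof.
move=> mxi /determinedP[phi ->]; rewrite !static_entropyE.
rewrite [leRHS](partition_big phi xpredT)//=; apply: ler_sum => j _.
rewrite prob_comp// mulr_suml -sumrN; apply: ler_sum => i /eqP ij.
rewrite lerN2; have := prob_ge0 (xi @^-1` [set i]); rewrite le_eqVlt.
case/orP=> [/eqP<-|pi0]; first by rewrite !mul0r.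
rewrite ler_pM2l// ler_ln ?posrE//.
  rewrite (bigD1 i) ?ij//= lerDl sumr_ge0// => *; exact: prob_ge0.
rewrite (bigD1 i) ?ij//= ltr_pwDl// sumr_ge0// => *; exact: prob_ge0.
Qed.

Lemma ln_leB1 (x : R) : 0 < x -> ln x <= x - 1.
Proof.
by move=> x0; rewrite -[in X in ln X](subrK 1 x) [x - 1 + 1]addrC le_ln1Dx//; lra.
Qed.

(** Subadditivity comes from [ln t <= t - 1] at [t = p i * q j / r i j]; the corrections
    [p i * q j - r i j] sum to 0 along each row. *)
Lemma static_entropy_pair (I J : finType) (xi : Y -> I) (zeta : Y -> J) :
  borel_partition xi -> borel_partition zeta ->
  borel_partition (fun x => (xi x, zeta x)) /\
  static_entropy mu (fun x => (xi x, zeta x)) <=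
  static_entropy mu xi + static_entropy mu zeta.
Proof.
move=> mxi mzeta; set pr := (fun x => (xi x, zeta x)).
have mpr : borel_partition pr.
  move=> [i j]; rewrite (_ : _ @^-1` _ = xi @^-1` [set i] `&` zeta @^-1` [set j]).
    by apply: measurableI.
  by apply/seteqP; split=> x /=; rewrite /pr /=; [case=> -> ->|case=> -> ->].
split=> //; rewrite !static_entropyE.
pose p i := prob (xi @^-1` [set i]); pose q j := prob (zeta @^-1` [set j]).
pose r i j := prob (pr @^-1` [set (i, j)]).
have r0 i j : 0 <= r i j by exact: prob_ge0.
have pE i : p i = \sum_j r i j.
  rewrite /p (_ : xi = fst \o pr)// prob_comp//.
  rewrite (eq_big (fun k : I * J => (k.1 == i) && true) (fun k => r k.1 k.2)).
  - by rewrite -(pair_big_dep (pred1 i) (fun _ _ => true) r)/= big_pred1_eq.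
  - by move=> k; rewrite andbT.
  - by case.
have qE j : q j = \sum_i r i j.
  rewrite /q (_ : zeta = snd \o pr)// prob_comp//.
  rewrite (eq_big (fun k : I * J => true && (k.2 == j)) (fun k => r k.1 k.2)).
  - rewrite -(pair_big_dep xpredT (fun _ => pred1 j) r)/=.
    by apply: eq_bigr => i _; rewrite big_pred1_eq.
  - by [].
  - by case.
have p0 i : 0 <= p i by exact: prob_ge0.
have q0 i : 0 <= q i by exact: prob_ge0.
have -> : \sum_i - (p i * ln (p i)) = \sum_i \sum_j - (r i j * ln (p i)).
  by apply: eq_bigr => i _; rewrite {1}pE mulr_suml sumrN.
have -> : \sum_i - (q i * ln (q i)) = \sum_i \sum_j - (r i j * ln (q j)).
  rewrite exchange_big/=.
  by apply: eq_bigr => i _; rewrite {1}qE mulr_suml sumrN.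
rewrite -big_split /= (eq_bigr (fun k => - (r k.1 k.2 * ln (r k.1 k.2)))); last first.
  by case.
rewrite -(pair_big xpredT xpredT (fun i j => - (r i j * ln (r i j))))/=.
have key i j : - (r i j * ln (r i j)) <=
    - (r i j * ln (p i)) + - (r i j * ln (q j)) + (p i * q j - r i j).
  have := r0 i j; rewrite le_eqVlt => /orP[/eqP<-|rij].
    by rewrite !mul0r oppr0 !add0r addr0 mulr_ge0.
  have pi0 : 0 < p i.
    by rewrite pE (bigD1 j)//= ltr_pwDl// sumr_ge0.
  have qj0 : 0 < q j.
    by rewrite qE (bigD1 i)//= ltr_pwDl// sumr_ge0.
  have H : ln (p i * q j / r i j) <= p i * q j / r i j - 1.
    by apply: ln_leB1; rewrite divr_gt0// mulr_gt0.
  rewrite ln_div ?posrE ?mulr_gt0// lnM ?posrE// -(ler_pM2l rij) in H.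
  have -> : p i * q j - r i j = r i j * (p i * q j / r i j - 1).
    by field; rewrite gt_eqF.
  by move: H; rewrite !mulrDr !mulrN; lra.
apply: (@le_trans _ _ (\sum_i \sum_j (- (r i j * ln (p i)) + - (r i j * ln (q j)) + (p i * q j - r i j)))).
  by apply: ler_sum => i _; apply: ler_sum => j _; exact: key.
apply: ler_sum => i _; rewrite big_split big_split /= gerDl.
by rewrite sumrB -mulr_sumr -pE (sum_prob mzeta) mulr1 subrr.
Qed.

Lemma static_entropy_cst (K : finType) (k : K) :
  borel_partition (fun _ : Y => k) /\ static_entropy mu (fun _ : Y => k) = 0.
Proof.
have cstE i : (fun _ : Y => k) @^-1` [set i] = setT  \/
    (fun _ : Y => k) @^-1` [set i] = set0.
  by have [->|ki] := pselect (k = i); [left|right]; apply/seteqP; split.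
split=> [i|].
  by have [->|->] := cstE i; [exact: measurableT|exact: measurable0].
rewrite static_entropyE big1// => i _; have [->|->] := cstE i.
  by rewrite probT ln1 mulr0 oppr0.
by rewrite prob0 mul0r oppr0.
Qed.

Lemma static_entropy_family (I J K : finType) (xi : I -> Y -> J) (zeta : Y -> K) :
  (forall i, borel_partition (xi i)) ->
  (forall x y, (forall i, xi i x = xi i y) -> zeta x = zeta y) ->
  borel_partition zeta /\
  static_entropy mu zeta <= \sum_i static_entropy mu (xi i).
Proof.
move=> mxi det.
(* Masking the labels outside [r] by [None] keeps all partial joins in one finite type, which allows
   induction on [r]. *)
pose z (r : seq I) (x : Y) : {ffun I -> option J} :=
  [ffun i => if i \in r then Some (xi i x) else None].
have zP r : borel_partition (z r) /\
    static_entropy mu (z r) <= \sum_(i <- r) static_entropy mu (xi i).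
  elim: r => [|i r [IHm IH]].
    have [m0 H0] := static_entropy_cst ([ffun=> None] : {ffun I -> option J}).
    rewrite big_nil (_ : z [::] = fun=> [ffun=> None]); first by rewrite H0.
    by apply/funext => x; apply/ffunP => i; rewrite !ffunE.
  have [mp Hp] := static_entropy_pair (mxi i) IHm.
  have zdet x y : (xi i x, z r x) = (xi i y, z r y) -> z (i :: r) x = z (i :: r) y.
    case=> xy zxy; apply/ffunP => j; rewrite !ffunE inE.
    case: eqVneq => [->|ji] /=; first by rewrite xy.
    by move/ffunP: zxy => /(_ j); rewrite !ffunE.
  split; first exact: borel_partition_determined zdet.
  by rewrite big_cons (le_trans (static_entropy_le mp zdet))// (le_trans Hp)// lerD2l.
have [mz Hz] := zP (index_enum I).
have zdet x y : z (index_enum I) x = z (index_enum I) y -> zeta x = zeta y.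
  move=> /ffunP xy; apply: det => i.
  by have := xy i; rewrite !ffunE mem_index_enum => -[].
split; first exact: borel_partition_determined zdet.
exact: le_trans (static_entropy_le mz zdet) Hz.
Qed.

End Entropy.

(** Apply [ln t <= t - 1] to the inverse square root of [p]: this bounds [- (p * ln p)] by twice
    [sqrt p - p]. *)
Lemma mul_ln_le (R : realType) (p s : R) : 0 <= p -> p <= s ^+ 2 -> 0 <= s ->
  - (p * ln p) <= 2 * s.
Proof.
rewrite le_eqVlt => /orP[/eqP<- _ s0|p0 ps s0]; first by rewrite mul0r oppr0 mulr_ge0.
have r0 : 0 < Num.sqrt p by rewrite sqrtr_gt0.
have rs : Num.sqrt p <= s by rewrite -(ger0_norm s0) -sqrtr_sqr ler_wsqrtr.
have := ln_leB1 (_ : 0 < (Num.sqrt p)^-1); rewrite invr_gt0 => /(_ r0).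
rewrite lnV ?posrE// => H.
have pE : p = Num.sqrt p ^+ 2 by rewrite sqr_sqrtr// ltW.
have -> : ln p = ln (Num.sqrt p) *+ 2 by rewrite {1}pE lnXn.
rewrite {1}pE mulr2n.
have : (Num.sqrt p) ^+ 2 * - ln (Num.sqrt p) <=
    (Num.sqrt p) ^+ 2 * ((Num.sqrt p)^-1 - 1).
  by rewrite ler_pM2l// exprn_gt0.
have -> : (Num.sqrt p) ^+ 2 * ((Num.sqrt p)^-1 - 1) = Num.sqrt p - (Num.sqrt p) ^+ 2.
  by field; rewrite gt_eqF.
have := sqr_ge0 (Num.sqrt p); rewrite mulrN mulrDr; lra.
Qed.

(** With [e = s ^+ 2], the likely cell contributes at most [s] and each of the others at most
    [2 * s]. The threshold depends only on the alphabet, neither on the space nor on the measure. *)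
Lemma static_entropy_small (R : realType) (I : finType) (delta : R) : 0 < delta ->
  exists2 e : R, 0 < e & forall (Y : ptopologicalType)
    (mu : probability (borel Y) R) (xi : Y -> I) (i0 : I),
    borel_partition xi -> prob mu (~` (xi @^-1` [set i0])) <= e ->
    static_entropy mu xi <= delta.
Proof.
move=> d0; pose n := #|I|; pose s : R := Num.min 1 (delta / (2 * n%:R + 1)).
have n0 : 0 < 2 * n%:R + 1 :> R by rewrite ltr_pwDr// mulr_ge0.
have s0 : 0 < s by rewrite lt_min ltr01 divr_gt0.
have s1 : s <= 1 by rewrite ge_min lexx.
have sd : (2 * n%:R + 1) * s <= delta.
  rewrite -ler_pdivlMl// mulrC ge_min; apply/orP; right.
  by rewrite mulrC.
exists (s ^+ 2); first by rewrite exprn_gt0.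
move=> Y mu xi i0 mxi Hs.
have ss : s ^+ 2 <= s by rewrite expr2 ger_pMl.
rewrite static_entropyE (bigD1 i0)//=.
have mi := mxi i0.
have H0 : - (prob mu (xi @^-1` [set i0]) * ln (prob mu (xi @^-1` [set i0]))) <= s.
  have p1 : 1 = prob mu (xi @^-1` [set i0]) + prob mu (~` (xi @^-1` [set i0])).
    rewrite -(probT mu) -(setUv (xi @^-1` [set i0])) probU ?setICr//.
    exact: measurableC.
  have := prob_ge0 mu (xi @^-1` [set i0]).
  rewrite le_eqVlt => /orP[/eqP<-|p0]; first by rewrite mul0r oppr0 ltW.
  set p := prob _ _ in p0 p1 *.
  have := ln_leB1 (_ : 0 < p^-1); rewrite invr_gt0 => /(_ p0).
  rewrite lnV ?posrE// -(ler_pM2l p0) mulrN => /le_trans; apply.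
  rewrite mulrBr mulr1 mulfV ?gt_eqF//; lra.
have H1 : \sum_(i | i != i0) - (prob mu (xi @^-1` [set i]) * ln (prob mu (xi @^-1` [set i]))) <= 2 * n%:R * s.
  apply: (@le_trans _ _ (\sum_(i | i != i0) 2 * s)).
    apply: ler_sum => i ii0; apply: mul_ln_le; [exact: prob_ge0| |exact: ltW].
    apply: le_trans Hs; apply: le_prob; [exact: mxi|exact: measurableC|].
    by move=> x /= -> /eqP; rewrite (negbTE ii0).
  rewrite sumr_const -[leLHS]mulr_natr mulrAC ler_wpM2r ?(ltW s0)//.
  by rewrite ler_wpM2l// ler_nat max_card.
apply: le_trans sd; lra.
Qed.

(** * Borel sets and their approximation by cylinders *)

Lemma borel_ind (Y : ptopologicalType) (P : set (set Y)) :
  (forall A, open A -> P A) -> (forall A, P A -> P (~` A)) ->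
  (forall F : (set Y)^nat, (forall n, P (F n)) -> P (\bigcup_n F n)) ->
  forall A : set (borel Y), measurable A -> P A.
Proof.
move=> Po PC PU A mA.
suff sub : <<s @open Y >> `<=` P by exact: sub mA.
apply: smallest_sub => //; split; first by apply: Po; exact: open0.
  by move=> B PB; rewrite setTD; exact: PC.
exact: PU.
Qed.

Lemma borel_open (Y : ptopologicalType) (A : set Y) :
  open A -> measurable (A : set (borel Y)).
Proof. by move=> oA; apply: sub_sigma_algebra. Qed.

Lemma borel_preimage (X Y : ptopologicalType) (f : X -> Y) (A : set (borel Y)) :
  continuous f -> measurable A -> measurable (f @^-1` A : set (borel X)).
Proof.
move=> cf.
apply: (@borel_ind Y (fun A => measurable (f @^-1` A : set (borel X)))) => {}A.
- by move=> oA; apply: borel_open; apply: open_comp.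
- by move=> mA; rewrite preimage_setC; exact: measurableC.
- by move=> mA; rewrite preimage_bigcup; exact: bigcup_measurable.
Qed.

Section Continuity.
Context {R : realType} {X : ptopologicalType} (mu : probability (borel X) R).

Lemma prob_tail (G : (set (borel X))^nat) : (forall n, measurable (G n)) ->
  nondecreasing_seq G -> forall e : R, 0 < e ->
  exists n, prob mu (\bigcup_n G n `\` G n) <= e.
Proof.
move=> mG ndG e e0; set B := \bigcup_n G n.
have mB : measurable B by exact: bigcup_measurable.
have mD n : measurable (B `\` G n) by exact: measurableD.
have D0 : \bigcap_n (B `\` G n) = set0.
  apply/seteqP; split=> x //= xB; have [[n _ Gn] _] := xB 0%N I.
  by have [_] := xB n I.
have := @nonincreasing_cvg_mu _ _ _ mu (fun n => B `\` G n).
rewrite D0 measure0 => /(_ _ mD measurable0 _)/fine_cvgP[].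
- by rewrite (le_lt_trans (probability_le1 _ _))// ltry.
- move=> n m nm; apply/subsetPset => x [Bx Gx]; split=> // Gnx; apply: Gx.
  by have /subsetPset := ndG _ _ nm; apply.
move=> _ /cvgrPdist_le/(_ e e0)[n _ /(_ n (leqnn n))] /=.
rewrite sub0r normrN ger0_norm ?fine_ge0//.
by exists n.
Qed.

Context (L : nat -> Type) (lab : forall N, X -> L N).
Hypothesis mlab : forall N (E : set X),
  (forall x y, lab N x = lab N y -> E x -> E y) -> measurable (E : set (borel X)).
Hypothesis lab_refine : forall N x y, lab N.+1 x = lab N.+1 y -> lab N x = lab N y.

Definition cylinder N (E : set X) := forall x y, lab N x = lab N y -> E x -> E y.

Definition approximable (A : set (borel X)) := measurable A /\
  forall e : R, 0 < e -> exists N (E : set X), cylinder N E /\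
    prob mu ((A `\` E) `|` (E `\` A)) <= e.

Lemma cylinder_le (N M : nat) (E : set X) : (N <= M)%N -> cylinder N E -> cylinder M E.
Proof.
move=> NM cE; have refineM x y : lab M x = lab M y -> lab N x = lab N y.
  elim: M NM => [|M IH]; first by rewrite leqn0 => /eqP ->.
  by rewrite leq_eqVlt => /orP[/eqP->//|/IH + /lab_refine].
by move=> x y /refineM; exact: cE.
Qed.

Lemma approximable_cylinder N E : cylinder N E -> approximable E.
Proof.
move=> cE; split; first exact: mlab cE.
by move=> e e0; exists N, E; split=> //; rewrite setDv setU0 prob0 ltW.
Qed.

Lemma approximableC A : approximable A -> approximable (~` A).
Proof.
move=> [mA aA]; split; first exact: measurableC.
move=> e /aA[N [E [cE H]]]; exists N, (~` E); split.
  by move=> x y xy Ex Ey; apply: Ex; apply: cE Ey.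
by rewrite !setDE !setCK setUC setIC [X in _ `|` X]setIC -!setDE.
Qed.

(** Continuity of the measure replaces the union by a single [G n] at the price of [e / 2]. *)
Lemma approximable_bigcup G : (forall n, approximable (G n)) ->
  nondecreasing_seq G -> approximable (\bigcup_n G n).
Proof.
move=> aG ndG; have mG n := (aG n).1; split; first exact: bigcup_measurable.
move=> e e0; have e20 : 0 < e / 2 by rewrite divr_gt0.
have [n Hn] := prob_tail mG ndG e20.
have [N [E [cE HE]]] := (aG n).2 _ e20; exists N, E; split=> //.
have mE := mlab cE.
have mB : measurable (\bigcup_n G n) by exact: bigcup_measurable.
rewrite (splitr e) (le_trans _ (lerD Hn HE))//.
apply: (le_trans _ (le_probU _ _ _)).
- apply: le_prob.
  + by apply: measurableU; exact: measurableD.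
  + by apply: measurableU; [|apply: measurableU]; exact: measurableD.
  + move=> x [[Bx Ex]|[Ex Bx]].
      by have [Gx|Gx] := pselect (G n x); [right; left|left].
    by right; right; split=> // Gx; apply: Bx; exists n.
- exact: measurableD.
- by apply: measurableU; exact: measurableD.
Qed.

Lemma approximableU A B : approximable A -> approximable B -> approximable (A `|` B).
Proof.
move=> [mA aA] [mB aB]; split; first exact: measurableU.
move=> e e0; have e20 : 0 < e / 2 by rewrite divr_gt0.
have [N [E [cE HE]]] := aA _ e20; have [M [F [cF HF]]] := aB _ e20.
have mE := mlab cE; have mF := mlab cF.
exists (maxn N M), (E `|` F); split.
  move=> x y xy [Ex|Fx]; [left; apply: cylinder_le cE _ _ xy Ex|
    right; apply: cylinder_le cF _ _ xy Fx]; by rewrite ?leq_maxl ?leq_maxr.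
rewrite (splitr e) (le_trans _ (lerD HE HF))//.
apply: (le_trans _ (le_probU _ _ _)).
- apply: le_prob.
  + by apply: measurableU; apply: measurableD; apply: measurableU.
  + by apply: measurableU; apply: measurableU; exact: measurableD.
  + move=> x [[[Ax|Bx] nEF]|[[Ex|Fx] nAB]].
    * by left; left; split=> // Ex; apply: nEF; left.
    * by right; left; split=> // Fx; apply: nEF; right.
    * by left; right; split=> // Ax; apply: nAB; left.
    * by right; right; split=> // Bx; apply: nAB; right.
- by apply: measurableU; exact: measurableD.
- by apply: measurableU; exact: measurableD.
Qed.

(** The hypothesis says that the labels determine [pi] topologically: a long enough label of [x]
    confines [pi] to a given neighbourhood of [pi x]. Preimages of open sets are then increasing
    unions of cylinders, and the approximable sets are stable under complement and countable
    union. *)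
Lemma approximable_preimage (Y : ptopologicalType) (pi : X -> Y) :
  (forall (B : set Y), open B -> forall x, B (pi x) ->
    exists N, forall y, lab N x = lab N y -> B (pi y)) ->
  forall B : set (borel Y), measurable B -> approximable (pi @^-1` B).
Proof.
move=> open_lab; apply: (@borel_ind Y (fun B => approximable (pi @^-1` B))) => [B oB|B|F aF].
(* [E N] is the largest cylinder of level [N] inside the preimage of [B]. *)
- pose E N := [set x | forall y, lab N x = lab N y -> B (pi y)].
  have cE N : cylinder N (E N) by move=> x y xy Ex z yz; apply: Ex; rewrite xy.
  rewrite (_ : _ @^-1` _ = \bigcup_N E N).
    apply: approximable_bigcup => [N|N M NM]; first exact: approximable_cylinder.
    apply/subsetPset => x Ex y xy; apply: Ex.
    by apply: (cylinder_le NM (E := [set y | lab N x = lab N y]) _ xy) => // z t /= <-.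
  apply/seteqP; split=> x /=; first by move=> /(open_lab _ oB)[N HN]; exists N.
  by move=> [N _]; apply.
- exact: approximableC.
(* Finite partial unions reduce the countable union to the increasing case. *)
- rewrite preimage_bigcup -bigcup_bigsetU_bigcup.
  apply: approximable_bigcup => [n|n m nm]; last first.
    by apply/subsetPset; apply: (@subset_bigsetU _ (fun i => pi @^-1` F i) n.+1 m.+1).
  elim: n.+1 => {n}[|n IH]; last by rewrite big_ord_recr; exact: approximableU.
  by rewrite big_ord0; apply: (@approximable_cylinder 0%N).
Qed.

End Continuity.

(* The junk value of a divergent limit is 0, hence the hypothesis on [C]. *)
Lemma limn_EFin_le (R : realType) (u : nat -> R) (C : R) : 0 <= C ->
  (forall delta, 0 < delta -> exists K, forall n, u n <= C + delta + K / n.+1%:R) ->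
  (limn (fun n => (u n)%:E) <= C%:E)%E.
Proof.
move=> C0 H; have [cu|/dvgP->] := pselect (cvgn (fun n => (u n)%:E)); last first.
  by rewrite lee_fin.
apply/lee_addgt0Pr => e e0; have [K HK] := H (e / 2) (divr_gt0 e0 (ltr0n _ 2)).
apply: lime_le => //; rewrite -EFinD.
have e20 : 0 < e / 2 by rewrite divr_gt0.
near=> n; rewrite lee_fin (le_trans (HK n))//.
rewrite {2}(splitr e) addrA lerD2l ler_pdivrMr// mulrC -ler_pdivrMr//.
rewrite (@le_trans _ _ n%:R)// ?ler_nat//.
by near: n; exact: nbhs_infty_ger.
Unshelve. all: by end_near. Qed.

(** * Entropy of a factor read through refining partitions *)

Section FlowEntropy.
Context {R : realType} {X : topological_flow R} (tau : R).
Implicit Types (mu : probability (borel X) R).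

Lemma flow_cont (t : R) : continuous (flow X t).
Proof. by have [] := flow_homeo X t. Qed.

Lemma flow_partition (I : finType) (xi : X -> I) t :
  borel_partition xi -> borel_partition (xi \o flow X t).
Proof.
by move=> mxi i; rewrite comp_preimage; apply: borel_preimage; [exact: flow_cont|].
Qed.

Lemma flow_static_entropy mu (I : finType) (xi : X -> I) t :
  invariant_measure mu -> borel_partition xi ->
  static_entropy mu (xi \o flow X t) = static_entropy mu xi.
Proof.
move=> imu mxi; rewrite !static_entropyE; apply: eq_bigr => i _.
by rewrite /prob comp_preimage imu.
Qed.

Lemma iter_flow (j : nat) (x : X) : iter j (flow X tau) x = flow X (j%:R * tau) x.
Proof.
elim: j => [|j IH] /=; first by rewrite mul0r flow0.
by rewrite IH -flowD -natr1 mulrDl mul1r addrC.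
Qed.

(** By invariance each time [t j] costs the same entropy, and subadditivity adds these costs up. *)
Lemma flow_itinerary mu (I J : finType) (xi : X -> I) (zeta : X -> J) (F : finType)
    (t : F -> R) : invariant_measure mu -> borel_partition xi ->
  (forall x y, (forall j, xi (flow X (t j) x) = xi (flow X (t j) y)) ->
    zeta x = zeta y) ->
  borel_partition zeta /\
  static_entropy mu zeta <= #|F|%:R * static_entropy mu xi.
Proof.
move=> imu mxi det.
have [|mz Hz] := static_entropy_family mu (xi := fun j => xi \o flow X (t j)) _ det.
  by move=> j; exact: flow_partition.
split=> //; apply: le_trans Hz _.
rewrite (eq_bigr (fun _ => static_entropy mu xi)); last first.
  by move=> j _; rewrite flow_static_entropy.
by rewrite sumr_const mulr_natl.
Qed.

Context (J : nat -> finType) (Q : forall N, X -> J N).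
Hypothesis mQ : forall N, borel_partition (Q N).
Hypothesis Q_refine : forall N x y, Q N.+1 x = Q N.+1 y -> Q N x = Q N y.

(** Place [k] holds time [k - N]. Time span and precision grow together, so that one index suffices
    for the refining sequence. *)
Definition window N (x : X) : {ffun 'I_(N.*2.+1) -> J N} :=
  [ffun k : 'I_(N.*2.+1) => Q N (flow X ((k%:R - N%:R) * tau) x)].

Lemma windowP N x y : window N x = window N y <->
  forall k, (k <= N.*2)%N ->
  Q N (flow X ((k%:R - N%:R) * tau) x) = Q N (flow X ((k%:R - N%:R) * tau) y).
Proof.
split=> [/ffunP xy k kN|xy]; last first.
  by apply/ffunP => k; rewrite !ffunE xy// -ltnS.
by have := xy (Ordinal (kN : (k < N.*2.+1)%N)); rewrite !ffunE.
Qed.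

Lemma window_refine N x y : window N.+1 x = window N.+1 y -> window N x = window N y.
Proof.
move=> /windowP xy; apply/windowP => k kN; apply: Q_refine.
have := xy k.+1; rewrite -natr1 -(natr1 N) opprD addrACA subrr addr0.
by apply; rewrite doubleS ltnS ltnW// ltnS.
Qed.

(* A finite partition [zeta] read through [pi] agrees, off a small set, with a
   function [xi'] of a long window of [Q N]. Its itinerary is thus determined by
   that of [Q N] and that of the label [err], which is mostly [None] and hence
   has small entropy: no conditional entropy is needed. *)
Lemma ks_entropy_le mu (Y : tds R) (pi : X -> Y) (C : R) :
  invariant_measure mu -> continuous pi ->
  (forall x, pi (flow X tau x) = tds_map Y (pi x)) ->
  (forall N, static_entropy mu (Q N) <= C) ->
  (forall B : set Y, open B -> forall x, B (pi x) ->
    exists N, forall y, window N x = window N y -> B (pi y)) ->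
  (ks_entropy (pushforward mu (pi : borel X -> borel Y)) (tds_map Y) <= C%:E)%E.
Proof.
move=> imu cpi pitau HC open_lab; apply: ge_ereal_sup => _ [k [xi [mxi ->]]].
have C0 : 0 <= C by apply: le_trans (HC 0%N); exact: static_entropy_ge0.
pose zeta := xi \o pi.
have mzeta : borel_partition zeta.
  by move=> i; rewrite comp_preimage; exact: borel_preimage (mxi i).
have mwin N : borel_partition (window N).
  have [|//] := @flow_itinerary mu _ _ (Q N) (window N) 'I_(N.*2.+1)
    (fun k => (k%:R - N%:R) * tau) imu (@mQ N).
  by move=> x y xy; apply/ffunP => j; rewrite !ffunE xy.
have mcyl N (E : set X) : (forall x y, window N x = window N y -> E x -> E y) ->
    measurable (E : set (borel X)).
  exact: (measurable_determined (mwin N)).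
have approx : forall i, approximable mu window (zeta @^-1` [set i]).
  move=> i; rewrite comp_preimage.
  exact: (@approximable_preimage _ _ mu _ window mcyl window_refine _ pi open_lab _ (mxi i)).
apply: limn_EFin_le => // delta delta0.
have [e e0 small] := static_entropy_small (option 'I_k) delta0.
(* Dividing by [k.+1] avoids a case distinction on [k = 0]; the [k] errors still sum to at most
   [e]. *)
have ek0 : 0 < e / k.+1%:R by rewrite divr_gt0.
have /choice[M /choice[E ME]] := fun i => (approx i).2 _ ek0.
pose N := \max_i M i.
have cE i : cylinder window N (E i).
  by apply: cylinder_le window_refine _ _ _ (leq_bigmax i) (ME i).1.
(* Off the error sets, [x] lies in [E i] exactly when [zeta x = i], so the cylinder picked is the
   right one. *)
pose xi' x : option 'I_k := [pick i | `[< E i x >]].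
have xi'_window x y : window N x = window N y -> xi' x = xi' y.
  move=> xy; apply: eq_pick => i /=; apply/asboolP/asboolP => Ei.
    by apply: cE Ei.
  by apply: cE Ei.
pose err x := if xi' x == Some (zeta x) then None else Some (zeta x).
have merr : borel_partition err.
  have mxi' : borel_partition xi' by exact: borel_partition_determined xi'_window.
  have [mp _] := static_entropy_pair mu mxi' mzeta.
  by apply: borel_partition_determined mp _ => x y [xy zxy]; rewrite /err xy zxy.
have Herr : static_entropy mu err <= delta.
  apply: (small _ _ _ None) => //.
  pose D i := (zeta @^-1` [set i] `\` E i) `|` (E i `\` zeta @^-1` [set i]).
  have mD i : measurable (D i : set (borel X)).
    by apply: measurableU; apply: measurableD; (exact: mzeta || exact: mcyl (cE i)).
  apply: (@le_trans _ _ (prob mu (\big[setU/set0]_(i < k) D i))).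
    apply: le_prob; first by apply: measurableC; exact: merr.
      exact: bigsetU_measurable.
    move=> x /= errx; rewrite -bigcup_seq.
    apply: contrapT => nD; apply: errx; rewrite /err /xi'.
    have ED i : E i x <-> zeta x = i.
      split=> [Ex|zx].
        by apply: contrapT => zx; apply: nD; exists i; rewrite /= ?mem_index_enum//; right.
      by apply: contrapT => Ex; apply: nD; exists i; rewrite /= ?mem_index_enum//; left.
    case: pickP => [i /asboolP/ED->|/(_ (zeta x))/asboolP]; first by rewrite eqxx.
    by case; apply/ED.
  apply: le_trans (le_prob_bigcup _ _ _) _ => //.
  apply: (@le_trans _ _ (\sum_(i < k) e / k.+1%:R)).
    by apply: ler_sum => i _; exact: (ME i).2.
  rewrite sumr_const card_ord -[leLHS]mulr_natr -mulrA ger_pMr//.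
  by rewrite mulrC ler_pdivrMr// mul1r ler_nat.
(* The [n.+1] successive windows of radius [N] cover [n.+1 + N.*2] times; the excess [N.*2] vanishes
   after division by [n.+1] in the limit. *)
exists (N.*2%:R * C) => n.
rewrite ler_pdivrMr// mulrDl mulfVK// [(C + delta) * _]mulrC.
pose zn x := itinerary (tds_map Y) xi n.+1 (pi x).
have znE x j : zn x j = zeta (flow X (j%:R * tau) x).
  rewrite ffunE /zeta /= -iter_flow; congr (xi _).
  by elim: (nat_of_ord j) => //= m ->; rewrite pitau.
pose qn x : {ffun 'I_(n.+1 + N.*2) -> J N} :=
  [ffun j : 'I_(n.+1 + N.*2) => Q N (flow X ((j%:R - N%:R) * tau) x)].
pose en x : {ffun 'I_n.+1 -> option 'I_k} :=
  [ffun j : 'I_n.+1 => err (flow X (j%:R * tau) x)].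
have [|mqn Hqn] := @flow_itinerary mu _ _ (Q N) qn 'I_(n.+1 + N.*2)
    (fun j => (j%:R - N%:R) * tau) imu (@mQ N).
  by move=> x y xy; apply/ffunP => j; rewrite !ffunE xy.
have [|men Hen] := @flow_itinerary mu _ _ err en 'I_n.+1
    (fun j => j%:R * tau) imu merr.
  by move=> x y xy; apply/ffunP => j; rewrite !ffunE xy.
have [mp Hp] := static_entropy_pair mu mqn men.
have zdet x y : (qn x, en x) = (qn y, en y) -> zn x = zn y.
  case=> /ffunP qxy /ffunP exy; apply/ffunP => j; rewrite !znE.
  have : xi' (flow X (j%:R * tau) x) = xi' (flow X (j%:R * tau) y).
    apply: xi'_window; apply/windowP => i iN.
    have ij : (i + j < n.+1 + N.*2)%N by rewrite addnC -addSn leq_add.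
    have := qxy (Ordinal ij); rewrite !ffunE /= natrD -!flowD.
    by rewrite -!mulrDl addrAC.
  have := exy j; rewrite !ffunE /err.
  case: eqP => [zx|_]; case: eqP => [zy|_] //; last by case.
  by rewrite zx zy => _ [].
change (static_entropy mu zn <= (n.+1%:R * (C + delta) + N.*2%:R * C)).
apply: (le_trans (static_entropy_le mu mp zdet)); apply: (le_trans Hp).
have H1 : static_entropy mu qn <= (n.+1 + N.*2)%:R * C.
  by rewrite (le_trans Hqn)// card_ord ler_wpM2l.
have H2 : static_entropy mu en <= n.+1%:R * delta.
  by rewrite (le_trans Hen)// card_ord ler_wpM2l.
apply: le_trans (lerD H1 H2) _; rewrite natrD; lra.
Qed.

End FlowEntropy.

(** * Local clocks and distances along orbits *)

Lemma continuous_minimum (R : realType) (X : topologicalType) (phi : R -> X -> R) (a : R) :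
  0 <= a -> continuous (fun p : R * X => phi p.1 p.2) ->
  exists G : X -> R, [/\ continuous G,
    forall x, exists t, [/\ - a <= t, t <= a & G x = phi t x]
    & forall x t, - a <= t -> t <= a -> G x <= phi t x].
Proof.
move=> a0 cphi.
have aa : - a <= a by rewrite (le_trans _ a0)// oppr_le0.
have cphil x : continuous (phi ^~ x).
  move=> t; have pc : (fun s : R => (s, x)) @ t --> (t, x).
    exact: (cvg_pair cvg_id (cvg_cst x)).
  exact: (cvg_comp _ _ pc (cphi (t, x))).
have /choice[c cP] : forall x, exists t, [/\ - a <= t, t <= a &
    forall s, - a <= s -> s <= a -> phi t x <= phi s x].
  move=> x; have [|t] := @EVT_min _ (phi ^~ x) _ _ aa.
    by apply: continuous_subspaceT; exact: cphil.
  rewrite in_itv /= => /andP[t1 t2] tmin; exists t; split=> // s s1 s2.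
  by apply: tmin; rewrite in_itv /= s1.
exists (fun x => phi (c x) x); split; last first.
- by move=> x t; have [_ _] := cP x; exact.
- by move=> x; exists (c x); have [] := cP x.
move=> x; apply/cvgrPdist_le => e e0.
have /compact_near_coveringP ncov := @segment_compact R (- a) a.
(* Compactness of the time interval makes the estimate uniform in [t], so that the minimisers at [x]
   and at [y] can be compared crosswise. *)
have near_phi : \forall y \near x, [set` `[- a, a]] `<=`
    [set t | `|phi t x - phi t y| <= e].
  apply: ncov => t _.
  have e20 : 0 < e / 2 by rewrite divr_gt0.
  have /cvgrPdist_le/(_ _ e20) := cphi (t, x).
  move=> [[A B] /= [At Bx] AB]; exists (A, B) => //= -[s y] /= [As By].
  have := AB (s, y) (conj As By); have := AB (s, x) (conj As (nbhs_singleton Bx)).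
  rewrite /= => H1 H2; rewrite (splitr e).
  rewrite -(subrKA (phi t x)) (le_trans (ler_normD _ _))// lerD//.
  by rewrite distrC.
near=> y.
have near_y t : - a <= t -> t <= a -> `|phi t x - phi t y| <= e.
  by move=> t1 t2; apply: (near near_phi y) => //=; rewrite in_itv /= t1.
have [cx1 cx2 cx3] := cP x; have [cy1 cy2 cy3] := cP y.
have := near_y _ cx1 cx2; have := near_y _ cy1 cy2.
have := cx3 _ cy1 cy2; have := cy3 _ cx1 cx2.
rewrite !ler_norml => H1 H2 /andP[H3 H4] /andP[H5 H6]; lra.
Unshelve. all: by end_near. Qed.

Section Steep.
Context {R : realType} (X : topological_flow R).

(** The preimages of [A] at the times [i * r], [i < N], are pairwise disjoint by the condition on
    return times and equally likely by invariance, so [N] copies of [prob mu A] fit into 1. *)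
Lemma disjoint_translates (mu : probability (borel X) R) (A : set (borel X))
    (r : R) (N : nat) :
  invariant_measure mu -> measurable A -> 0 < r -> (0 < N)%N ->
  (forall x s, r <= s -> s <= N%:R * r -> A x -> ~ A (flow X s x)) ->
  prob mu A <= N%:R^-1.
Proof.
move=> imu mA r0 N0 Adisj.
pose B (i : nat) : set (borel X) := flow X (i%:R * r) @^-1` A.
have mB i : measurable (B i) by apply: borel_preimage => //; exact: flow_cont.
have HB n : (n <= N)%N -> prob mu (\big[setU/set0]_(i < n) B i) = n%:R * prob mu A.
  elim: n => [_|n IH nN]; first by rewrite big_ord0 prob0 mul0r.
  rewrite big_ord_recr /= probU//; last 2 first.
  - exact: bigsetU_measurable.
  - apply/seteqP; split=> x //= -[]; rewrite -bigcup_mkord => -[i /= ni Bi] Bn.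
    apply: (Adisj (flow X (i%:R * r) x) ((n - i)%:R * r)) => //.
    + by rewrite ler_peMl ?(ltW r0)// ler1n subn_gt0.
    + by rewrite ler_wpM2r ?(ltW r0)// ler_nat (leq_trans (leq_subr _ _))// ltnW.
    + by rewrite -flowD -mulrDl -natrD subnK ?(ltnW ni).
  rewrite IH ?(ltnW nN)// /B {2}/prob imu// -/(prob mu A).
  by rewrite -natr1 mulrDl mul1r.
rewrite -div1r ler_pdivlMr ?ltr0n// mulrC -HB//.
by apply: prob_le1; exact: bigsetU_measurable.
Qed.

Context (d : X -> X -> R).
Hypothesis d0 : forall x y, d x y = 0 <-> x = y.
Hypothesis dC : forall x y, d x y = d y x.
Hypothesis dT : forall x y z, d x z <= d x y + d y z.
Hypothesis dnbhs : forall (x : X) (A : set X),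
  nbhs x A <-> exists2 e : R, 0 < e & [set y | d x y < e] `<=` A.

Lemma dist_ge0 x y : 0 <= d x y.
Proof.
have := dT x y x; rewrite (proj2 (d0 x x) erefl) [d y x]dC; lra.
Qed.

Lemma dist_continuous x : continuous (d x).
Proof.
move=> y; apply/cvgrPdist_lt => e e0; apply/dnbhs; exists e => // z /= yz.
have := dT x y z; have := dT x z y; rewrite [d z y]dC ltr_norml; lra.
Qed.

Lemma joint_gt (Phi : R * X -> R) (t0 : R) (w : X) (c : R) :
  continuous Phi -> c < Phi (t0, w) ->
  exists2 r, 0 < r & forall t x, `|t - t0| < r -> d w x < r -> c < Phi (t, x).
Proof.
move=> cPhi cw.
have [[A B] /= [/nbhs_ballP[r1 /= r10 Ar] /dnbhs[r2 r20 Br]] AB] :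
    \forall p \near (t0, w), c < Phi p.
  exact: (cvgr_gt _ (cPhi (t0, w)) _ cw).
exists (Num.min r1 r2); first by rewrite lt_min r10.
move=> t x; rewrite !lt_min => /andP[tr _] /andP[_ xr].
by apply: (AB (t, x)); split; [apply: Ar; rewrite /ball /= distrC|exact: Br].
Qed.

(** The factor [s] is taken to be 1 or -1, for the flow and for its reversal. *)
Lemma flow_joint_continuous (f : X -> R) (s : R) : continuous f ->
  continuous (fun p : R * X => f (flow X (s * p.1) p.2)).
Proof.
move=> cf p.
apply: (@continuous_comp _ _ _ (fun p : R * X => flow X (s * p.1) p.2) f); last exact: cf.
apply: (@continuous_comp _ _ _ (fun p : R * X => (s * p.1, p.2))
  (fun p : R * X => flow X p.1 p.2)); last exact: flow_continuous.
have H1 : (s * q.1) @[q --> p] --> s * p.1.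
  by apply: cvgM; [exact: cvg_cst|exact: cvg_fst].
have H2 : q.2 @[q --> p] --> p.2 by exact: cvg_snd.
exact: (cvg_pair H1 H2).
Qed.

(* [G x] is the cost of reaching [x] from [w] by a jump of price [K * distance]
   followed by the flow for a (signed) time [t], [|t| <= a]. For large [K] and
   [x] near [w] the optimal [t] stays away from the endpoints of [-a, a], so
   that flowing by [s] just shifts it. *)
Lemma local_clock (w : X) (a : R) : 0 < a -> flow X a w <> w ->
  exists (G : X -> R) (r : R), [/\ continuous G, 0 < r &
    forall x s, d w x < r -> d w (flow X s x) < r -> `|s| <= r / 2 ->
      G (flow X s x) = G x + s].
Proof.
move=> a0 aw.
have wa : flow X (- a) w <> w.
  by move=> E; apply: aw; rewrite -{1}E -flowD subrr flow0.
have dp y : y <> w -> 0 < d w y.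
  by move=> yw; rewrite lt_neqAle dist_ge0 andbT eq_sym; apply/eqP => /d0/esym.
pose m := Num.min (d w (flow X a w)) (d w (flow X (- a) w)).
have m0 : 0 < m by rewrite lt_min !dp.
(* With this [K] the cost at [t = a] and at [t = - a] exceeds [2 * a] near [w], whereas the choice
   [t = 0] costs less than [a] once [d w x < a / K]. *)
pose K := 4 * a / m.
have K0 : 0 < K by rewrite divr_gt0// mulr_gt0.
pose phi t x := K * d w (flow X (-1 * t) x) + t.
have cphi : continuous (fun p : R * X => phi p.1 p.2).
  move=> p; apply: cvgD; last exact: cvg_fst.
  apply: cvgM; first exact: cvg_cst.
  exact: (flow_joint_continuous (@dist_continuous w)).
have [G [cG Gmin Gle]] := continuous_minimum (ltW a0) cphi.
have Km y : m <= d w y -> 4 * a <= K * d w y.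
  by move=> my; rewrite /K mulrAC ler_pdivlMr// ler_wpM2l// mulr_ge0// ltW.
have [|r1 r10 Hr1] := @joint_gt _ a w (2 * a) cphi.
  rewrite /phi /= mulN1r; have := Km (flow X (- a) w); rewrite ge_min lexx orbT.
  by move=> /(_ isT); lra.
have [|r2 r20 Hr2] := @joint_gt _ (- a) w (2 * a) cphi.
  rewrite /phi /= mulN1r opprK; have := Km (flow X a w); rewrite ge_min lexx.
  by move=> /(_ isT); lra.
pose r := Num.min (Num.min r1 r2) (a / K).
have r0 : 0 < r by rewrite !lt_min r10 r20 divr_gt0.
(* An optimal time for [x], shifted by [s], is an admissible candidate for [flow X s x]; the reverse
   inequality is the same one with the two points exchanged. *)
have half x s : d w x < r -> d w (flow X s x) < r -> `|s| <= r / 2 ->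
    G (flow X s x) <= G x + s.
  rewrite !lt_min => /andP[/andP[x1 x2] x3] _ sr.
  have [t [t1 t2 Gt]] := Gmin x.
  have Gx : G x < a.
    have := Gle x 0; rewrite /phi mulr0 flow0 addr0 oppr_le0 => /(_ (ltW a0) (ltW a0)).
    by move=> /le_lt_trans; apply; rewrite mulrC -ltr_pdivlMr.
  have rr : r <= r1 /\ r <= r2 by rewrite /r !ge_min !lexx ?orbT.
  have ta : r <= `|t - a|.
    rewrite leNgt; apply/negP => ta.
    have := Hr1 t x (lt_le_trans ta rr.1) x1; rewrite /= -Gt; lra.
  have ta' : r <= `|t - - a|.
    rewrite leNgt; apply/negP => ta'.
    have := Hr2 t x (lt_le_trans ta' rr.2) x2; rewrite /= -Gt; lra.
  have := Gle (flow X s x) (t + s).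
  rewrite /phi -flowD (_ : -1 * (t + s) + s = -1 * t); last by ring.
  rewrite addrA -/(phi t x) -Gt; apply.
    by move: ta ta' sr; rewrite !ler_norml !ler_normr; lra.
  by move: ta ta' sr; rewrite !ler_norml !ler_normr; lra.
exists G, r; split=> // x s xr sxr sr; apply/le_anti; rewrite half//=.
have := half (flow X s x) (- s); rewrite -flowD addNr flow0 normrN.
by move=> /(_ sxr xr sr); lra.
Qed.

(* [chi] is the inf-convolution of the distance to [w] with [|t|] along the
   orbits. *)
Lemma flow_lipschitz_distance (w : X) : exists chi : X -> R,
  [/\ continuous chi, chi w = 0, forall x, 0 <= chi x,
      forall x s, `|chi (flow X s x) - chi x| <= `|s|
    & forall r, 0 < r -> exists2 m, 0 < m & forall x, chi x < m -> d w x < r].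
Proof.
pose phi t x := d w (flow X (1 * t) x) + `|t|.
have cphi : continuous (fun p : R * X => phi p.1 p.2).
  move=> p; apply: cvgD; last by apply: cvg_norm; exact: cvg_fst.
  exact: (flow_joint_continuous (@dist_continuous w)).
have [M [cM Mmin Mle]] := continuous_minimum ler01 cphi.
have M0 x : 0 <= M x.
  by have [t [_ _ ->]] := Mmin x; rewrite addr_ge0// dist_ge0.
(* Truncation at 1 makes up for the bound on the times: [t - s] can leave [[-1, 1]] only if the
   right-hand side is already at least 1. *)
have half x s : Num.min 1 (M (flow X s x)) <= Num.min 1 (M x) + `|s|.
  rewrite {2}/Num.min; case: ltP => [_|M1]; first by rewrite ge_min lerDl normr_ge0.
  have [t [t1 t2 Mt]] := Mmin x; rewrite Mt.
  rewrite ge_min; have [ts|ts] := leP 1 (phi t x + `|s|) => //=.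
  have ts1 : `|t - s| <= 1.
    apply: le_trans (ler_normB _ _) _; apply: le_trans (ltW ts).
    by rewrite lerD2r /phi lerDr dist_ge0.
  have := Mle (flow X s x) (t - s); rewrite /phi -flowD.
  rewrite (_ : 1 * (t - s) + s = 1 * t); last by ring.
  move: ts1; rewrite ler_norml => /andP[H1 H2] /(_ H1 H2) /le_trans; apply.
  by rewrite -addrA lerD2l ler_normB.
exists (fun x => Num.min 1 (M x)); split.
- move=> x; apply: (@continuous_min _ _ (fun=> 1) M); [exact: cvg_cst|exact: cM].
- have Mw : M w = 0.
    apply/le_anti; rewrite M0 andbT; have := Mle w 0.
    rewrite /phi mulr0 flow0 normr0 addr0 (proj2 (d0 w w) erefl).
    by apply; rewrite ?oppr_le0.
  by rewrite Mw min_r.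
- by move=> x; rewrite le_min ler01 M0.
- move=> x s; rewrite ler_norml; apply/andP; split.
    have := half (flow X s x) (- s); rewrite -flowD addNr flow0 normrN; lra.
  have := half x s; lra.
(* A small [chi x] gives a small [t] with [flow X t x] close to [w]; flowing back by [- t] recovers
   [x], and joint continuity at [(0, w)] controls this return. *)
move=> r r0; have [||m m0 Hm] := @joint_gt (fun p => - d w (flow X (-1 * p.1) p.2)) 0 w (- r).
- move=> p; apply: cvgN; exact: (flow_joint_continuous (@dist_continuous w)).
- by rewrite /= mulr0 flow0 (proj2 (d0 w w) erefl) oppr0 oppr_lt0.
exists (Num.min 1 m); first by rewrite lt_min ltr01.
move=> x; have [t [t1 t2 Mt]] := Mmin x.
rewrite gt_min !lt_min ltxx /= Mt => /andP[_ Hx].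
have t_m : `|t - 0| < m.
  by rewrite subr0 (le_lt_trans _ Hx)// lerDr dist_ge0.
have x_m : d w (flow X t x) < m.
  by rewrite (le_lt_trans _ Hx)// /phi mul1r lerDl.
have := Hm _ _ t_m x_m; rewrite /= ltrN2 mulN1r -flowD addNr flow0.
by [].
Qed.

End Steep.

(** * A function with uniformly thin level bands *)

Section SteepFunction.
Context {R : realType} (X : topological_flow R).

Lemma borel_le (f : X -> R) (c : R) : continuous f ->
  measurable ([set x | c <= f x] : set (borel X)).
Proof.
move=> cf; rewrite (_ : [set x | _] = ~` (f @^-1` [set y | y < c])).
  by apply: measurableC; apply: borel_open; apply: open_comp => //; exact: open_lt.
by apply/seteqP; split=> x /=; [move=> H; apply/negP; rewrite -leNgt|
  move/negP; rewrite -leNgt].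
Qed.

Lemma borel_lt (f : X -> R) (c : R) : continuous f ->
  measurable ([set x | f x < c] : set (borel X)).
Proof.
move=> cf; apply: borel_open; apply: (@open_comp _ _ f [set y | y < c]) => //.
Qed.

(** The level [v = 1] is the complement of the bump and may carry most of the measure, hence the
    restriction to [p < 1]. *)
Lemma steep_function (w w' : X) (a : R) : flow X a w <> w -> w <> w' ->
  exists v : X -> R, [/\ continuous v, forall x, 0 <= v x <= 1, v w = 0, v w' = 1
  & forall p e, p < 1 -> 0 < e -> exists2 lam, 0 < lam &
      forall mu : probability (borel X) R, invariant_measure mu ->
      prob mu [set x | p <= v x /\ v x < p + lam] <= e].
Proof.
wlog a0 : a / 0 < a => [wl aw|aw ww'].
  have [a0|a0|a0] := ltgtP a 0; last by move: aw; rewrite a0 flow0.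
    apply: (wl (- a)); first by rewrite oppr_gt0.
    by move=> E; apply: aw; rewrite -{1}E -flowD subrr flow0.
  exact: (wl a).
have [d [d0 dC dT dnbhs]] := flow_metrizable X.
have [G [r1 [cG r10 clock]]] := local_clock d0 dC dT dnbhs a0 aw.
have [chi [cchi chiw chi0 chiL chi_small]] := flow_lipschitz_distance d0 dC dT dnbhs w.
pose r := Num.min r1 (d w w').
have r0 : 0 < r.
  rewrite lt_min r10 lt_neqAle (dist_ge0 d0 dC dT) andbT eq_sym.
  by apply/eqP => /d0.
have rr1 : r <= r1 by rewrite ge_min lexx.
have [m m0 Hm] := chi_small _ r0.
(* A positive [u x] forces [chi x < 2 * eta = m], hence [d w x < r]: the clock is valid there, and
   [w'] is excluded because [r <= d w w']. *)
pose eta := m / 2; have eta0 : 0 < eta by rewrite divr_gt0.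
pose g x := G x - G w.
pose u x := Num.max 0 (eta - `|g x| - chi x / 2).
have cu : continuous u.
  move=> x; apply: (@continuous_max _ _ (fun=> 0) (fun x => eta - `|g x| - chi x / 2)); first exact: cvg_cst.
  apply: cvgB; last by apply: cvgM; [exact: cchi|exact: cvg_cst].
  apply: cvgB; first exact: cvg_cst.
  by apply: cvg_norm; apply: cvgB; [exact: cG|exact: cvg_cst].
have u_pos x : 0 < u x -> d w x < r /\ u x = eta - `|g x| - chi x / 2.
  rewrite /u lt_max ltxx /= => H; split; last by rewrite max_r// ltW.
  by apply: Hm; move: H (normr_ge0 (g x)); rewrite /eta; lra.
have u0 x : 0 <= u x by rewrite /u le_max lexx.
have u_eta x : u x <= eta.
  rewrite /u ge_max (ltW eta0) /=; have := normr_ge0 (g x); have := chi0 x; lra.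
exists (fun x => 1 - u x / eta); split.
- move=> x; apply: cvgB; first exact: cvg_cst.
  by apply: cvgM; [exact: cu|exact: cvg_cst].
- move=> x; have : 0 <= u x / eta by rewrite divr_ge0// ltW.
  have : u x / eta <= 1 by rewrite ler_pdivrMr// mul1r.
  lra.
- have -> : u w = eta by rewrite /u /g subrr normr0 chiw mul0r !subr0 max_r// ltW.
  by rewrite divff ?subrr// gt_eqF.
- have [/u_pos[+ _]|uw'] := ltP 0 (u w').
    by rewrite lt_min ltxx andbF.
  by rewrite (_ : u w' = 0) ?mul0r ?subr0//; apply/le_anti; rewrite uw' u0.
move=> p e p1 e0.
(* Each side of [G = G w] will contribute at most [1 / N], whence the numerator 2. *)
pose N := (Num.truncn (2 / e)).+1.
have N0 : 0 < N%:R :> R by rewrite ltr0n.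
have Ne : 2 * N%:R^-1 <= e.
  rewrite ler_pdivrMr// mulrC -ler_pdivrMr//.
  by apply: ltW; have := truncnS_gt (2 / e).
(* With slope at least 1/2, a band of height [rho] in [u] is crossed within time [2 * rho], and [N]
   such times just fill the range [r / 2] of the clock. *)
pose rho := r / 2 / (2 * N%:R).
have rho0 : 0 < rho by rewrite !divr_gt0// mulr_gt0.
have Nrho : N%:R * (2 * rho) = r / 2 by rewrite /rho; field; rewrite gt_eqF.
(* The bound [1 - p] keeps [u] positive on the band, and [rho / eta] translates height [rho] in [u]
   into height in [v]. *)
pose lam := Num.min (1 - p) (rho / eta).
exists lam; first by rewrite lt_min subr_gt0 p1 divr_gt0.
move=> mu imu; set A := [set x | _].
have AU x : A x -> [/\ d w x < r, u x = eta - `|g x| - chi x / 2,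
    eta * (1 - p) - rho < u x & u x <= eta * (1 - p)].
  move=> [H1 H2].
  have H3 : u x / eta <= 1 - p by lra.
  have : 1 - p - lam < u x / eta by lra.
  rewrite ltr_pdivlMr// => H4; rewrite ler_pdivrMr// in H3.
  have lam1 : lam <= 1 - p by rewrite ge_min lexx.
  have lam2 : lam * eta <= rho by rewrite -ler_pdivlMr// ge_min lexx orbT.
  have [|? ?] := u_pos x.
    by apply: le_lt_trans H4; rewrite mulr_ge0// ?(ltW eta0)//; lra.
  by split=> //; [move: H4; rewrite !mulrBl ![_ * eta]mulrC; lra|rewrite mulrC].
have cv : continuous (fun x => 1 - u x / eta).
  move=> x; apply: cvgB; first exact: cvg_cst.
  by apply: cvgM; [exact: cu|exact: cvg_cst].
have cg : continuous g by move=> x; apply: cvgB; [exact: cG|exact: cvg_cst].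
have mA : measurable (A : set (borel X)).
  rewrite (_ : A = [set x | p <= 1 - u x / eta] `&` [set x | 1 - u x / eta < p + lam])//.
  by apply: measurableI; [exact: borel_le cv|exact: borel_lt cv].
(* Between two points of an orbit piece with [g >= 0], [u] drops by at least half the elapsed time;
   with [g < 0] it rises by as much. *)
pose Ap := A `&` [set x | 0 <= g x]; pose An := A `&` [set x | g x < 0].
have mAp : measurable (Ap : set (borel X)).
  by apply: measurableI => //; exact: borel_le cg.
have mAn : measurable (An : set (borel X)).
  by apply: measurableI => //; exact: borel_lt cg.
have AE : A = Ap `|` An.
  rewrite -setIUr; apply/seteqP; split=> x => [Ax|[]//]; split=> //=.
  by have [H|H] := leP 0 (g x); [left|right].
have move_A x s : A x -> A (flow X s x) -> 2 * rho <= s -> s <= N%:R * (2 * rho) ->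
   g (flow X s x) = g x + s /\ `|chi (flow X s x) - chi x| <= s.
  rewrite Nrho => /AU[xr _ _ _] /AU[sxr _ _ _] s1 s2.
  have sge0 : 0 <= s by apply: le_trans s1; rewrite mulr_ge0// ltW.
  split; last by rewrite (le_trans (chiL _ _))// ger0_norm.
  rewrite /g clock; first by rewrite addrAC.
  - exact: lt_le_trans rr1.
  - exact: lt_le_trans rr1.
  - by rewrite ger0_norm// (le_trans s2)// ler_pM2r.
have half_p : prob mu Ap <= N%:R^-1.
  apply: (@disjoint_translates _ _ _ _ (2 * rho)) => //; first by rewrite mulr_gt0.
  move=> x s s1 s2 [Ax gx] [Asx gsx].
  have [Eg Ec] := move_A _ _ Ax Asx s1 s2.
  have [_ ux _ ux'] := AU _ Ax; have [_ usx usx' _] := AU _ Asx.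
  rewrite (ger0_norm gx) in ux; rewrite (ger0_norm gsx) in usx.
  move: Ec; rewrite ler_norml; lra.
have half_n : prob mu An <= N%:R^-1.
  apply: (@disjoint_translates _ _ _ _ (2 * rho)) => //; first by rewrite mulr_gt0.
  move=> x s s1 s2 [Ax gx] [Asx gsx].
  have [Eg Ec] := move_A _ _ Ax Asx s1 s2.
  have [_ ux ux' _] := AU _ Ax; have [_ usx _ usx'] := AU _ Asx.
  rewrite (ltr0_norm gx) in ux; rewrite (ltr0_norm gsx) in usx.
  move: Ec; rewrite ler_norml; lra.
rewrite AE (le_trans (le_probU _ _ _))//; lra.
Qed.

End SteepFunction.

(** * Staircase functions on the line *)

Lemma continuous_sumr (R : realType) (T : topologicalType) (I : Type) (r : seq I)
    (F : I -> T -> R) :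
  (forall i, continuous (F i)) -> continuous (fun x => \sum_(i <- r) F i x).
Proof.
move=> cF; elim: r => [|i r IH].
  rewrite (_ : (fun _ => _) = fun=> 0); first by move=> x; exact: cvg_cst.
  by apply/funext => x; rewrite big_nil.
rewrite (_ : (fun _ => _) = fun x => F i x + \sum_(j <- r) F j x).
  by move=> x; apply: cvgD; [exact: cF|exact: IH].
by apply/funext => x; rewrite big_cons.
Qed.

Section Stair.
Context {R : realType}.
Implicit Types (y z lam : R) (M k : nat).

Definition clamp y : R := Num.max 0 (Num.min 1 y).

Lemma clamp_le0 y : y <= 0 -> clamp y = 0.
Proof. by move=> y0; rewrite /clamp max_l// ge_min y0 orbT. Qed.

Lemma clamp_ge1 y : 1 <= y -> clamp y = 1.
Proof. by move=> y1; rewrite /clamp min_l// max_r. Qed.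

Lemma clamp_id y : 0 <= y -> y <= 1 -> clamp y = y.
Proof. by move=> y0 y1; rewrite /clamp min_r// max_r. Qed.

Lemma le_clamp y z : y <= z -> clamp y <= clamp z.
Proof.
by move=> yz; rewrite /clamp ge_max !le_max lexx /= le_min !ge_min lexx yz !orbT.
Qed.

(* On [0, M], [stair M lam] rises from [k] to [k + 1] on [k, k + lam] and is
   constant on [k + lam, k + 1]. *)
Definition stair M lam y : R := \sum_(k < M) clamp ((y - k%:R) / lam).

Lemma stair_continuous M lam : continuous (stair M lam).
Proof.
apply: continuous_sumr => k y.
apply: (@continuous_max _ _ (fun=> 0) (fun y => Num.min 1 ((y - k%:R) / lam))).
  exact: cvg_cst.
apply: (@continuous_min _ _ (fun=> 1) (fun y => (y - k%:R) / lam)).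
  exact: cvg_cst.
by apply: cvgM; [apply: cvgB; [exact: cvg_id|exact: cvg_cst]|exact: cvg_cst].
Qed.

Lemma le_stair M lam y z : 0 < lam -> y <= z -> stair M lam y <= stair M lam z.
Proof.
move=> l0 yz; apply: ler_sum => k _; apply: le_clamp.
by rewrite ler_pM2r ?invr_gt0// lerD2r.
Qed.

Lemma stair_nat M lam y k : 0 < lam -> (k <= M)%N ->
  (forall j, (j < k)%N -> j%:R + lam <= y) -> y <= k%:R -> stair M lam y = k%:R.
Proof.
move=> l0 kM jk yk; rewrite /stair.
have -> : k%:R = \sum_(j < M) (if (j < k)%N then 1 else 0) :> R.
  by rewrite -big_mkcond /= -(big_ord_widen M (fun=> 1))// sumr_const card_ord.
apply: eq_bigr => j _; case: ltnP => [jltk|kj].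
  by rewrite clamp_ge1// ler_pdivlMr// mul1r lerBrDl jk.
rewrite clamp_le0// pmulr_lle0 ?invr_gt0// subr_le0 (le_trans yk)//.
by rewrite ler_nat.
Qed.

Lemma stair_fix M lam k : 0 < lam -> lam <= 1 -> (k <= M)%N ->
  stair M lam k%:R = k%:R.
Proof.
move=> l0 l1 kM; apply: stair_nat => // j jk.
by rewrite (le_trans (_ : _ <= j%:R + 1))// ?lerD2l// natr1 ler_nat.
Qed.

(** The value is the ceiling of [y], because each rise begins at an integer. *)
Lemma stair_plateau M lam y : 0 < lam -> lam <= 1 -> 0 <= y -> y <= M%:R ->
  (forall k, (k < M)%N -> ~ (k%:R < y /\ y < k%:R + lam)) ->
  exists k, (k <= M)%N /\ stair M lam y = k%:R.
Proof.
move=> l0 l1 y0 yM gap; have := truncn_itv y0.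
set k := Num.truncn y => /andP[]; rewrite le_eqVlt => /orP[/eqP ky _|ky yk].
  have kM : (k <= M)%N by rewrite -(ler_nat R) ky.
  by exists k; split=> //; rewrite -ky stair_fix.
have kM : (k < M)%N by rewrite -(ltr_nat R) (lt_le_trans ky).
exists k.+1; split=> //; apply: stair_nat => //; last exact: ltW.
move=> j; rewrite ltnS => jk; rewrite (le_trans (_ : _ <= k%:R + lam))//.
  by rewrite lerD2r ler_nat.
by rewrite leNgt; apply/negP => ylt; exact: (gap k).
Qed.

(** This is the staircase with [lam = 1], the diagonal with which [stair_ge] compares the steeper
    ones. *)
Lemma sum_clamp M y : 0 <= y -> \sum_(k < M) clamp (y - k%:R) = Num.min y M%:R.
Proof.
move=> y0; elim: M => [|M IH]; first by rewrite big_ord0 min_r.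
rewrite big_ord_recr IH /= -natr1; have [yM|My] := leP y M%:R.
  by rewrite clamp_le0 ?subr_le0// addr0 !min_l// (le_trans yM)// lerDl.
have [yM1|My1] := leP y (M%:R + 1).
  by rewrite clamp_id; [rewrite addrC subrK|rewrite subr_ge0 ltW|rewrite lerBlDl].
by rewrite clamp_ge1// lerBrDl ltW.
Qed.

Lemma stair_ge M lam y : 0 < lam -> lam <= 1 -> 0 <= y -> y <= M%:R ->
  y <= stair M lam y.
Proof.
move=> l0 l1 y0 yM; rewrite -{1}(min_l yM) -sum_clamp//; apply: ler_sum => k _.
have [yk|ky] := leP (y - k%:R) 0.
  by rewrite clamp_le0// le_max lexx.
by apply: le_clamp; rewrite ler_peMr ?(ltW ky)// invf_ge1.
Qed.

Lemma stair_le M lam y : 0 < lam -> lam <= 1 -> 0 <= y -> y <= M%:R ->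
  stair M lam y <= y + 1.
Proof.
move=> l0 l1 y0 yM; have /andP[k1 k2] := truncn_itv y0.
set k := Num.truncn y in k1 k2.
have : stair M lam y <= stair M lam k.+1%:R by apply: le_stair => //; exact: ltW.
have [kM|Mk] := ltnP k M.
  by rewrite stair_fix// -natr1 => /le_trans; apply; rewrite lerD2r.
move=> _; apply: (le_trans (le_stair _ l0 yM)); rewrite stair_fix//.
by have : M%:R <= k%:R :> R; [rewrite ler_nat|lra].
Qed.

Lemma stair_le_max M lam y : 0 < lam -> lam <= 1 -> y <= M%:R ->
  stair M lam y <= M%:R.
Proof. by move=> l0 l1 yM; rewrite -[leRHS](@stair_fix M lam M)//; exact: le_stair. Qed.

End Stair.

(** * Iterated rounding to dyadic values *)

Section Staircase.
Context {R : realType} (X : topological_flow R).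
Implicit Types (f : X -> R) (mu : probability (borel X) R).

(* Only open bands are considered: the level sets of [f] may be large. *)
Definition no_atoms f := forall p e, 0 < e -> exists2 lam, 0 < lam &
  forall mu, invariant_measure mu -> prob mu [set x | p < f x /\ f x < p + lam] <= e.

Lemma borel_gt f (c : R) : continuous f -> measurable ([set x | c < f x] : set (borel X)).
Proof.
move=> cf; apply: borel_open; apply: (@open_comp _ _ f [set y | c < y]) => //.
Qed.

Lemma borel_eq f (c : R) : continuous f -> measurable ([set x | f x = c] : set (borel X)).
Proof.
move=> cf; rewrite (_ : [set x | _] = [set x | c <= f x] `&` ~` [set x | c < f x]).
  by apply: measurableI; [exact: borel_le|apply: measurableC; exact: borel_gt].
apply/seteqP; split=> x /=; first by move=> ->; rewrite lexx ltxx.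
by move=> [H1 /negP]; rewrite -leNgt => H2; apply/le_anti/andP.
Qed.

Lemma borel_oo f (a b : R) : continuous f ->
  measurable ([set x | a < f x /\ f x < b] : set (borel X)).
Proof. by move=> cf; apply: measurableI; [exact: borel_gt|exact: borel_lt]. Qed.

(** A nondecreasing [h] pulls a short open band above [p] back into an open band above the last
    point where [h <= p]; a plateau of [h] at height [p] itself stays outside. *)
Lemma no_atoms_comp f (h : R -> R) : continuous f -> (forall x, 0 <= f x) ->
  continuous h -> {homo h : x y / x <= y} -> no_atoms f -> no_atoms (h \o f).
Proof.
move=> cf f0 ch mh nf p e e0.
have chf : continuous (h \o f) by move=> x; apply: continuous_comp; [exact: cf|exact: ch].
have empty l : 0 < l -> (forall x, ~ (p < h (f x) /\ h (f x) < p + l)) ->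
    exists2 lam, 0 < lam & forall mu, invariant_measure mu ->
      prob mu [set x | p < (h \o f) x /\ (h \o f) x < p + lam] <= e.
  move=> l0 H; exists l => // mu _; rewrite (_ : [set x | _] = set0).
    by rewrite prob0 ltW.
  by apply/seteqP; split=> x //= /H.
(* Degenerate cases: when [h] never exceeds [p], or already [h 0 > p], some band above [p] contains
   no value of [h \o f]. *)
have [[y1 py1]|nh] := pselect (exists y, p < h y); last first.
  by apply: (empty 1) => // x [px _]; apply: nh; exists (f x).
have [h0p|ph0] := leP (h 0) p; last first.
  apply: (empty (h 0 - p)); first by rewrite subr_gt0.
  by move=> x [_]; rewrite addrC subrK ltNge mh.
pose S := [set y | h y <= p].
have S_ub : has_ubound S.
  exists y1 => y /= hy; rewrite leNgt; apply/negP => /ltW/mh; rewrite leNgt => /negP; apply.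
  exact: le_lt_trans py1.
have clS : closed S.
  by apply: (@closed_comp _ _ h [set z | z <= p]); [move=> *; exact: ch|exact: closed_le].
have Sq : S (sup S).
  by rewrite [S in S _](closure_id S).1//; apply: closure_sup => //; exists 0.
have [lam l0 Hlam] := nf (sup S) e e0.
have ht : p < h (sup S + lam).
  rewrite ltNge; apply/negP => hle; have := ub_le_sup S_ub hle.
  by rewrite leNgt ltrDl l0.
exists (h (sup S + lam) - p); first by rewrite subr_gt0.
move=> mu imu; apply: le_trans (Hlam mu imu); apply: le_prob.
- exact: borel_oo.
- exact: borel_oo.
move=> x /= [px]; rewrite addrC subrK => xp; split; rewrite ltNge; apply/negP => H.
  by have := lt_le_trans px (mh _ _ H); rewrite ltNge Sq.
by have := mh _ _ H; rewrite leNgt xp.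
Qed.

Definition lattice n f : set X := [set x | exists k : nat, 2 ^+ n * f x = k%:R].

Lemma borel_lattice n f : continuous f -> (forall x, 0 <= f x <= 1) ->
  measurable (lattice n f : set (borel X)).
Proof.
move=> cf f01.
rewrite (_ : lattice n f = \bigcup_(k : nat) (f @^-1` [set k%:R / 2 ^+ n])).
  by apply: bigcup_measurable => k _; exact: borel_eq.
apply/seteqP; split=> x; rewrite /lattice /=.
  by move=> [k kE]; exists k => //=; rewrite -kE mulrAC divff ?mul1r// expf_neq0.
by move=> [k _ /= ->]; exists k; rewrite mulrC mulfVK// expf_neq0.
Qed.

Record stage (w w' : X) f : Prop := Stage {
  stage_continuous : continuous f;
  stage_itv : forall x, 0 <= f x <= 1;
  stage_w : f w = 0;
  stage_w' : f w' = 1;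
  stage_no_atoms : no_atoms f }.

(** Rescaled by [M = 2 ^ n], the staircase rounds [f] up by at most one lattice step and fixes the
    lattice. Only the [M] open rises can stay off the lattice, and a short [lam] makes each of them
    cost at most [e / M]. *)
Lemma stage_step (w w' : X) f n (e : R) : 0 < e -> stage w w' f ->
  exists f', [/\ stage w w' f',
    forall x, f x <= f' x <= f x + 2 ^- n,
    forall m x, (m <= n)%N -> lattice m f x -> f' x = f x
  & forall mu, invariant_measure mu -> prob mu (~` lattice n f') <= e].
Proof.
move=> e0 [cf f01 fw fw' nf]; pose M := (2 ^ n)%N.
have M2 : M%:R = 2 ^+ n :> R by rewrite natrX.
have M0 : 0 < M%:R :> R by rewrite M2 exprn_gt0.
have eM : 0 < e / M%:R by rewrite divr_gt0.
(* [N] counts the rises already treated, while the scale [M] stays fixed. *)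
have /(_ M)[lam [l0 l1 Hlam]] : forall N, exists lam, [/\ 0 < lam, lam <= 1 &
    forall k, (k < N)%N -> forall mu, invariant_measure mu ->
    prob mu [set x | k%:R < M%:R * f x /\ M%:R * f x < k%:R + lam] <= e / M%:R].
  elim=> [|N [lam [l0 l1 IH]]]; first by exists 1; split.
  have [lam' l0' H'] := nf (N%:R / M%:R) _ eM.
  exists (Num.min lam (M%:R * lam')); split.
  - by rewrite lt_min l0 mulr_gt0.
  - by rewrite ge_min l1.
  move=> k; rewrite ltnS leq_eqVlt => /orP[/eqP->|kN] mu imu.
    apply: le_trans (H' mu imu); apply: le_prob.
    + by apply: (@borel_oo (fun x => M%:R * f x)) => x; apply: cvgM; [exact: cvg_cst|exact: cf].
    + exact: borel_oo.
    move=> x /= [H1 H2]; rewrite ltr_pdivrMr// mulrC; split=> //.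
    rewrite -(ltr_pM2l M0) mulrDr mulrCA mulfV ?gt_eqF// mulr1.
    by rewrite (lt_le_trans H2)// lerD2l ge_min lexx orbT.
  apply: le_trans (IH k kN mu imu); apply: le_prob.
  + by apply: (@borel_oo (fun x => M%:R * f x)) => x; apply: cvgM; [exact: cvg_cst|exact: cf].
  + by apply: (@borel_oo (fun x => M%:R * f x)) => x; apply: cvgM; [exact: cvg_cst|exact: cf].
  by move=> x /= [-> H2]; split=> //; rewrite (lt_le_trans H2)// lerD2l ge_min lexx.
have Mf x : 0 <= M%:R * f x <= M%:R.
  by have /andP[? ?] := f01 x; rewrite mulr_ge0 ?ler_piMr// ltW.
pose h y := stair M lam (M%:R * y) / M%:R.
have cs : continuous (stair M lam \o (fun y => M%:R * y)).
  move=> y; apply: continuous_comp; last exact: stair_continuous.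
  by apply: cvgM; [exact: cvg_cst|exact: cvg_id].
have ch : continuous h by move=> y; apply: cvgM; [exact: cs|exact: cvg_cst].
have mh : {homo h : x y / x <= y}.
  move=> x y xy; rewrite ler_pM2r ?invr_gt0//; apply: le_stair => //.
  by rewrite ler_pM2l.
have hfix k : (k <= M)%N -> h (k%:R / M%:R) = k%:R / M%:R.
  by move=> kM; rewrite /h [M%:R * _]mulrC mulfVK ?gt_eqF// stair_fix.
have cf' : continuous (h \o f).
  by move=> x; apply: continuous_comp; [exact: cf|exact: ch].
have h0 : h 0 = 0 by have := hfix 0%N (leq0n _); rewrite mul0r.
have h1 : h 1 = 1 by have := hfix M (leqnn _); rewrite divff ?gt_eqF.
have f01' x : 0 <= (h \o f) x <= 1.
  have /andP[? ?] := f01 x; apply/andP.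
  by split; [rewrite -[leLHS]h0 mh|rewrite -[leRHS]h1 mh].
exists (h \o f); split.
- split=> //=; rewrite ?fw ?fw' ?h0 ?h1//.
  by apply: no_atoms_comp => // x; have /andP[] := f01 x.
- move=> x; have /andP[H1 H2] := Mf x; rewrite /= /h -M2.
  rewrite ler_pdivlMr// ler_pdivrMr// [f x * _]mulrC stair_ge//=.
  by rewrite mulrDl mulVf ?gt_eqF// [f x * _]mulrC stair_le.
- move=> m x mn [k kE] /=.
  have -> : f x = (k * 2 ^ (n - m))%N%:R / M%:R.
    rewrite natrM -kE natrX M2 -{2}(subnK mn) exprD; field.
    by rewrite !expf_neq0.
  apply: hfix; rewrite -(ler_nat R) natrM -kE natrX M2 -{2}(subnKC mn) exprD.
  rewrite mulrAC ler_piMr ?mulr_ge0 ?exprn_ge0//.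
  by have /andP[] := f01 x.
move=> mu imu.
pose gap (k : nat) : set (borel X) := [set x | k%:R < M%:R * f x /\ M%:R * f x < k%:R + lam].
have mgap k : measurable (gap k).
  by apply: (@borel_oo (fun x => M%:R * f x)) => x; apply: cvgM; [exact: cvg_cst|exact: cf].
apply: (@le_trans _ _ (prob mu (\big[setU/set0]_(k < M) gap k))).
  apply: le_prob.
  - by apply: measurableC; exact: borel_lattice.
  - exact: bigsetU_measurable.
  move=> x nlat; rewrite -bigcup_mkord; apply: contrapT => nB; apply: nlat.
  have /andP[H1 H2] := Mf x.
  have [k kM Hk|k [kM Hk]] := @stair_plateau _ M lam _ l0 l1 H1 H2.
    by apply: nB; exists k.
  by exists k; rewrite /= /h Hk -M2 mulrC mulfVK// gt_eqF.
apply: (le_trans (le_prob_bigcup _ _ _)) => //.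
apply: (@le_trans _ _ (\sum_(k < M) e / M%:R)).
  by apply: ler_sum => k _; exact: Hlam.
by rewrite sumr_const card_ord -[leLHS]mulr_natr mulfVK ?gt_eqF.
Qed.

End Staircase.

Section Limit.
Context {R : realType} (X : topological_flow R).

(** The stages increase with summable steps, so they converge uniformly. A point on the lattice of
    level [n] at stage [n.+1] is never moved again, so the estimate of that stage passes to the
    limit. *)
Lemma stage_limit (w w' : X) (f0 : X -> R) (e : nat -> R) :
  (forall n, 0 < e n) -> stage w w' f0 ->
  exists f : X -> R, [/\ continuous f, forall x, 0 <= f x <= 1, f w = 0, f w' = 1 &
    (forall x, f0 x = 1 -> f x = 1) /\
    forall n mu, invariant_measure mu -> prob mu (~` lattice n f) <= e n].
Proof.
move=> e0 sf0; pose stg := {f : X -> R | stage w w' f}.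
have /choice[step stepP] : forall p : nat * stg, exists f' : stg,
    [/\ forall x, sval p.2 x <= sval f' x <= sval p.2 x + 2 ^- p.1,
    forall m x, (m <= p.1)%N -> lattice m (sval p.2) x -> sval f' x = sval p.2 x
  & forall mu, invariant_measure mu -> prob mu (~` lattice p.1 (sval f')) <= e p.1].
  move=> [n [f sf]]; have [f' [sf' H1 H2 H3]] := stage_step n (e0 n) sf.
  by exists (exist _ f' sf').
pose F := fix F n : stg := if n is m.+1 then step (m, F m) else exist _ f0 sf0.
have FS n := stepP (n, F n).
pose f_ n := sval (F n).
have f_st n : stage w w' (f_ n) := svalP (F n).
have f_inc n m x : (n <= m)%N -> f_ n x <= f_ m x.
  elim: m => [|m IH]; first by rewrite leqn0 => /eqP->.
  rewrite leq_eqVlt => /orP[/eqP->//|nm]; apply: le_trans (IH nm) _.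
  by have [/(_ x)/andP[]] := FS m.
(* The increments [2 ^- k] for [n <= k < m] sum exactly to [2 * 2 ^- n - 2 * 2 ^- m]. *)
have f_close n m x : (n <= m)%N -> f_ m x <= f_ n x + 2 * 2 ^- n - 2 * 2 ^- m.
  elim: m => [|m IH]; first by rewrite leqn0 => /eqP->; rewrite addrK.
  rewrite leq_eqVlt => /orP[/eqP->//|nm]; first by rewrite addrK.
  have [/(_ x)/andP[_ /= H] _ _] := FS m; have := IH nm.
  rewrite -/(f_ m) -/(f_ m.+1) in H *.
  have -> : 2 ^- m = 2 * 2 ^- m.+1 :> R.
    by rewrite exprS invfM mulrA divff ?mul1r.
  have E : 2 ^- m = 2 * 2 ^- m.+1 :> R by rewrite exprS invfM mulrA divff ?mul1r.
  move: H; rewrite E; lra.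
have f_lat n m k x : (k <= n <= m)%N -> lattice k (f_ n) x -> f_ m x = f_ n x.
  elim: m => [|m IH] /andP[kn]; first by rewrite leqn0 => /eqP->.
  rewrite leq_eqVlt => /orP[/eqP->//|nm] lat.
  have mn : f_ m x = f_ n x by apply: IH => //; rewrite kn.
  have [_ /(_ k x _ _) H _] := FS m; rewrite -mn; apply: H.
    by rewrite (leq_trans kn).
  by move: lat; rewrite /lattice /= -/(f_ m) mn.
(* By monotonicity the limit is a supremum, so bounds and frozen values can be checked stage by
   stage. *)
pose f x := sup (range (f_ ^~ x)).
have f_ub x : has_ubound (range (f_ ^~ x)).
  by exists 1 => _ [n _ <-]; have /andP[] := stage_itv (f_st n) x.
have f_ne x : range (f_ ^~ x) !=set0 by exists (f_ 0%N x); exists 0%N.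
have f_le n x : f_ n x <= f x by apply: ub_le_sup => //; exists n.
have le_f c x : (forall n, f_ n x <= c) -> f x <= c.
  by move=> H; apply: ge_sup => // _ [n _ <-].
have f_dist n x : `|f x - f_ n x| <= 2 * 2 ^- n.
  rewrite ger0_norm ?subr_ge0// lerBlDl; apply: le_f => m.
  have [nm|/ltnW mn] := leqP n m.
    rewrite (le_trans (f_close _ _ x nm))// gerBl mulr_ge0// invr_ge0 exprn_ge0//.
  rewrite (le_trans (f_inc _ _ x mn))// lerDl mulr_ge0// invr_ge0 exprn_ge0//.
have f_fix k n x : (k <= n)%N -> lattice k (f_ n) x -> f x = f_ n x.
  move=> kn lat; apply/le_anti; rewrite f_le andbT; apply: le_f => m.
  have [nm|/ltnW mn] := leqP n m; last exact: f_inc.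
  by rewrite (f_lat n m k)// kn.
have cf : continuous f.
  move=> x; apply/cvgrPdist_le => eps eps0.
  have [n Hn] : exists n, 2 * 2 ^- n <= eps / 3.
    exists (Num.truncn (6 / eps)); rewrite ler_pdivrMr ?exprn_gt0//.
    set k := Num.truncn _.
    have : 6 / eps < k.+1%:R by exact: truncnS_gt.
    rewrite ltr_pdivrMr// => H.
    have : k.+1%:R <= 2 ^+ k :> R by rewrite -natrX ler_nat ltn_expl.
    rewrite -(ler_pM2r eps0) => H'.
    have H'' : 6 <= 2 ^+ k * eps by lra.
    by rewrite mulrAC ler_pdivlMr// mulrC; lra.
  have cfn : continuous (f_ n) by have [] := f_st n.
  have /cvgrPdist_le/(_ (eps / 3)) := cfn x.
  rewrite divr_gt0// => /(_ isT); apply: filterS => y Hy.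
  have := f_dist n x; have := f_dist n y; move: Hy; rewrite !ler_norml; lra.
have f01 x : 0 <= f x <= 1.
  have /andP[H1 _] := stage_itv (f_st 0%N) x.
  rewrite (le_trans H1 (f_le _ _))/=; apply: le_f => n.
  by have /andP[] := stage_itv (f_st n) x.
exists f; split=> //.
- apply/le_anti; rewrite le_f/=; last by move=> n; rewrite (stage_w (f_st n)).
  by rewrite -(stage_w (f_st 0%N)) f_le.
- apply/le_anti; rewrite le_f/=; last by move=> n; rewrite (stage_w' (f_st n)).
  by rewrite -(stage_w' (f_st 0%N)) f_le.
split.
  move=> x fx; rewrite (f_fix 0%N 0%N)//.
  by exists 1%N; rewrite expr0 mul1r.
move=> n mu imu; have [_ _ /(_ mu imu) /=] := FS n; apply: le_trans.
rewrite -/(F n.+1) -/(f_ n.+1); apply: le_prob.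
- by apply: measurableC; apply: borel_lattice.
- by apply: measurableC; apply: borel_lattice; have [] := f_st n.+1.
move=> x nlat lat; apply: nlat; move: (lat) => [k kE]; exists k.
by rewrite (f_fix n n.+1).
Qed.

(** The index of [e] is shifted: [e 0] controls the value 1 and [e n.+1] the lattice of level [n],
    in accordance with [special] below. *)
Lemma staircase (w w' : X) (a : R) (e : nat -> R) : (forall n, 0 < e n) ->
  flow X a w <> w -> w <> w' ->
  exists f : X -> R, [/\ continuous f, forall x, 0 <= f x <= 1, f w = 0, f w' = 1 &
    forall mu, invariant_measure mu ->
      prob mu (~` [set x | f x = 1]) <= e 0%N /\
      forall n, prob mu (~` lattice n f) <= e n.+1].
Proof.
move=> e0 aw ww'; have [v [cv v01 vw vw' Hv]] := steep_function aw ww'.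
have [lam0 lam00 Hlam0] := Hv 0 (e 0%N) ltr01 (e0 0%N).
pose lam := Num.min 1 lam0.
have l0 : 0 < lam by rewrite lt_min ltr01.
have l1 : lam <= 1 by rewrite ge_min lexx.
(* This initial stage is [min 1 (v / lam)]: it equals 1 off the band [v < lam], and 1 is a lattice
   point of level 0, kept by every later stage. *)
have sv : stage w w' (stair 1 lam \o v).
  have v1 x : 0 <= v x <= 1%:R by [].
  have s0 : stair 1 lam 0 = 0 := @stair_fix R 1 lam 0 l0 l1 isT.
  have s1 : stair 1 lam 1 = 1 := @stair_fix R 1 lam 1 l0 l1 isT.
  split.
  - by move=> x; apply: continuous_comp; [exact: cv|exact: stair_continuous].
  - move=> x; have /andP[? ?] := v1 x; apply/andP; split.
      by rewrite -[leLHS]s0; exact: le_stair.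
    exact: stair_le_max.
  - by rewrite /= vw.
  - by rewrite /= vw'.
  apply: no_atoms_comp => //.
  - by move=> x; have /andP[] := v01 x.
  - exact: stair_continuous.
  - by move=> x y; exact: le_stair.
  (* The steep function controls its bands only for [p < 1]; for larger [p] the open band is
     empty. *)
  move=> p eps eps0; have [p1|p1] := ltP p 1.
    have [l l00 Hl] := Hv p eps p1 eps0; exists l => // mu imu.
    apply: le_trans (Hl mu imu); apply: le_prob.
    - exact: borel_oo.
    - by apply: measurableI; [exact: borel_le|exact: borel_lt].
    - by move=> x /= [/ltW].
  exists 1 => // mu imu; rewrite (_ : [set x | _] = set0) ?prob0 ?ltW//.
  apply/seteqP; split=> x //= [px _].
  by have /andP[_] := v01 x; rewrite leNgt (le_lt_trans p1).
have [f [cf f01 fw fw' [f1 Hf]]] := stage_limit (fun n => e0 n.+1) sv.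
exists f; split=> // mu imu; split; last by move=> n; exact: Hf.
apply: le_trans (Hlam0 mu imu); apply: le_prob.
- by apply: measurableC; exact: borel_eq.
- by apply: measurableI; [exact: borel_le|exact: borel_lt].
move=> x /= fx1; have /andP[v0 v1] := v01 x; split=> //.
rewrite add0r ltNge; apply/negP => lamv; apply: fx1; apply: f1 => /=.
apply: (@stair_nat _ 1 lam _ 1) => // j; rewrite ltnS leqn0 => /eqP->.
by rewrite add0r (le_trans _ lamv)// ge_min lexx orbT.
Qed.

End Limit.

(** * The quotient defined by a sequence of functions *)

(** From a compact space to a Hausdorff one, [p] is a closed map, so the preimage of a closed set
    under [f] is the image of a closed set under [p]. *)
Lemma continuous_quotient (X Y Z : topologicalType) (p : X -> Y) (f : Y -> Z) :
  compact [set: X] -> hausdorff_space Y -> continuous p -> p @` setT = setT ->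
  continuous (f \o p) -> continuous f.
Proof.
move=> cX hY cp sp cf; apply/continuous_closedP => C clC.
rewrite (_ : f @^-1` C = p @` ((f \o p) @^-1` C)).
  apply: compact_closed => //; apply: continuous_compact.
    by apply: continuous_subspaceT.
  apply: subclosed_compact cX _ => //.
  by move/continuous_closedP : cf; apply.
apply/seteqP; split=> y /=; last by move=> [x Cx <-].
move=> Cy; have [x _ xy] : (p @` setT) y by rewrite sp.
by exists x; rewrite /= ?xy.
Qed.

Section Separation.
Context {R : realType} {X : ptopologicalType} (G : nat -> X -> R).

(** The pullback along [x] to [(G m x)_m] of a metric for the product topology on real sequences. *)
Definition sepdist (x y : X) : R :=
  sup (range (fun m => Num.min 1 `|G m x - G m y| / 2 ^+ m)).

Lemma sepdist_term_le (x y : X) m :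
  Num.min 1 `|G m x - G m y| / 2 ^+ m <= 2 ^- m.
Proof. by rewrite ler_piMl ?invr_ge0 ?exprn_ge0// ge_min lexx. Qed.

Lemma sepdist_ubound (x y : X) :
  has_ubound (range (fun m => Num.min 1 `|G m x - G m y| / 2 ^+ m)).
Proof.
exists 1 => _ [m _ <-]; rewrite (le_trans (sepdist_term_le _ _ _))//.
by rewrite invf_le1 ?exprn_gt0// exprn_ege1// ler1n.
Qed.

Lemma le_sepdist (x y : X) m :
  Num.min 1 `|G m x - G m y| / 2 ^+ m <= sepdist x y.
Proof. by apply: ub_le_sup; [exact: sepdist_ubound|exists m]. Qed.

Lemma sepdist_le (x y : X) c :
  (forall m, Num.min 1 `|G m x - G m y| / 2 ^+ m <= c) -> sepdist x y <= c.
Proof.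
move=> H; apply: ge_sup; last by move=> _ [m _ <-].
by eexists; exists 0%N.
Qed.

Lemma sepdist_eq0 (x y : X) : sepdist x y = 0 <-> forall m, G m x = G m y.
Proof.
split=> [xy0 m|xy]; last first.
  apply/le_anti/andP; split.
    by apply: sepdist_le => m; rewrite xy subrr normr0 min_r// mul0r.
  by have := le_sepdist x y 0; rewrite xy subrr normr0 min_r// mul0r.
apply/eqP; rewrite -subr_eq0 -normr_le0.
have := le_sepdist x y m; rewrite xy0 pmulr_lle0 ?invr_gt0 ?exprn_gt0//.
by rewrite ge_min leNgt ltr01.
Qed.

Lemma sepdistC (x y : X) : sepdist x y = sepdist y x.
Proof. by rewrite /sepdist; under eq_fun do rewrite distrC. Qed.

Lemma sepdist_triangle (y x z : X) : sepdist x z <= sepdist x y + sepdist y z.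
Proof.
apply: sepdist_le => m; apply: le_trans (lerD (le_sepdist x y m) (le_sepdist y z m)).
rewrite -mulrDl ler_pM2r ?invr_gt0 ?exprn_gt0//.
have := ler_distD (G m y) (G m x) (G m z).
have := normr_ge0 (G m x - G m y); have := normr_ge0 (G m y - G m z).
by rewrite /Num.min; do 3 (case: ltP => ?); lra.
Qed.

Definition rep (x : X) : X := xget point [set y | forall m, G m y = G m x].

Lemma repP x m : G m (rep x) = G m x.
Proof. by rewrite /rep; case: xgetP => [y -> //|/(_ x) /=]; case. Qed.

Lemma rep_eq x y : (forall m, G m x = G m y) -> rep x = rep y.
Proof.
move=> xy; rewrite /rep; congr xget; apply/funext => z /=.
by apply/propext; split=> zx m; rewrite zx xy.
Qed.

Lemma rep_idem x : rep (rep x) == rep x.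
Proof. by apply/eqP/rep_eq => m; rewrite repP. Qed.

(** The quotient is realised on chosen representatives; its topology comes from [sepdist], not from
    the inclusion into [X]. *)
Definition sepquot := {x : X | rep x == x}.

HB.instance Definition _ := Choice.on sepquot.

Definition sepproj (x : X) : sepquot := exist _ (rep x) (rep_idem x).

Lemma sepquot_eq0 (u v : sepquot) : sepdist (sval u) (sval v) = 0 -> u = v.
Proof.
move/sepdist_eq0/rep_eq; case: u v => [x xx] [y yy] /=.
by rewrite (eqP xx) (eqP yy) => xy; apply: val_inj.
Qed.

HB.instance Definition _ := isMetric.Build R sepquot
  (fun u => (sepdist_eq0 _ _).2 (fun=> erefl)) sepquot_eq0
  (fun u v => sepdistC (sval u) (sval v))
  (fun u v z => sepdist_triangle (sval u) (sval v) (sval z)).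

HB.instance Definition _ := isPointed.Build sepquot (sepproj point).

Lemma sepquot_ball (x y : X) e : ball (sepproj x) e (sepproj y) <-> sepdist x y < e.
Proof.
rewrite ballEmdist /= /mdist /=.
suff -> : sepdist (rep x) (rep y) = sepdist x y by [].
by rewrite /sepdist; under eq_fun do rewrite !repP.
Qed.

Lemma sepprojK (u : sepquot) : sepproj (sval u) = u.
Proof. by apply: val_inj; rewrite /= (eqP (svalP u)). Qed.

Lemma sepproj_eq x y : sepproj x = sepproj y <-> forall m, G m x = G m y.
Proof.
split=> [/(congr1 sval) /= xy m|xy]; first by rewrite -(repP x) xy repP.
by apply: val_inj; exact: rep_eq.
Qed.

Lemma sepproj_surj : sepproj @` setT = setT.
Proof. by apply/seteqP; split=> // u _; exists (sval u) => //; exact: sepprojK. Qed.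

Lemma sepdist_small (e : R) : 0 < e -> exists M, forall x y,
  (forall m, (m < M)%N -> `|G m x - G m y| < e) -> sepdist x y <= e.
Proof.
move=> e0; exists (Num.truncn e^-1) => x y H; apply: sepdist_le => m.
have [mM|Mm] := ltnP m (Num.truncn e^-1).
  rewrite ler_pdivrMr ?exprn_gt0// ge_min; apply/orP; right.
  by rewrite (le_trans (ltW (H m mM)))// ler_peMr ?(ltW e0)// exprn_ege1// ler1n.
apply: le_trans (sepdist_term_le _ _ _) _.
rewrite -[leRHS]invrK lef_pV2 ?posrE ?invr_gt0 ?exprn_gt0//.
rewrite (le_trans (ltW (truncnS_gt _)))// (@le_trans _ _ m.+1%:R) ?ler_nat//.
by rewrite -natrX ler_nat ltn_expl.
Qed.

Lemma sepproj_continuous : (forall m, continuous (G m)) -> continuous sepproj.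
Proof.
move=> cG x; apply/cvg_ballP => e e0.
have e20 : 0 < e / 2 by rewrite divr_gt0.
have [M HM] := sepdist_small e20.
suff near_G : forall N, \forall y \near x, forall m, (m < N)%N -> `|G m x - G m y| < e / 2.
  apply: filterS (near_G M) => y /HM xy; apply/sepquot_ball.
  by rewrite (le_lt_trans xy)// ltr_pdivrMr// ltr_pMr// ltr1n.
elim=> [|N IH]; first by near=> y.
have /cvgrPdist_lt/(_ _ e20) := cG N x; move: IH; apply: filterS2 => y H1 H2 m.
by rewrite ltnS leq_eqVlt => /orP[/eqP->|/H1].
Unshelve. all: by end_near. Qed.

Lemma sepproj_open (B : set sepquot) x : open B -> B (sepproj x) ->
  exists M (e : R), 0 < e /\ forall y,
    (forall m, (m < M)%N -> `|G m x - G m y| < e) -> B (sepproj y).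
Proof.
move=> oB Bx; have /nbhs_ballP[e /= e0 eB] := open_nbhs_nbhs (conj oB Bx).
have e20 : 0 < e / 2 by rewrite divr_gt0.
have [M HM] := sepdist_small e20; exists M, (e / 2); split=> // y /HM xy.
apply: eB; apply/sepquot_ball.
by rewrite (le_lt_trans xy)// ltr_pdivrMr// ltr_pMr// ltr1n.
Qed.

Lemma sepquot_metrizable : metrizable R sepquot.
Proof.
exists (fun u v => sepdist (sval u) (sval v)); split.
- by move=> u v; split=> [/sepquot_eq0//|->]; exact/sepdist_eq0.
- by move=> u v; exact: sepdistC.
- by move=> u v z; exact: sepdist_triangle.
move=> u B; have bE e : ball u e = [set v | sepdist (sval u) (sval v) < e].
  by rewrite ballEmdist.
split=> [/nbhs_ballP[e e0 eB]|[e e0 eB]]; first by exists e; rewrite // -bE.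
by apply/nbhs_ballP; exists e; rewrite // bE.
Qed.

Lemma sepquot_hausdorff : hausdorff_space sepquot.
Proof. exact: metric_hausdorff. Qed.

End Separation.

(** Stability of the family under the map and its inverse lets both descend to the quotient. The
    last clause, that finitely many functions control each neighbourhood, feeds the entropy
    bound. *)
Lemma factor_of_functions (R : realType) (A : tds R) (G : nat -> A -> R) :
  (forall m, continuous (G m)) ->
  (forall m, exists m', forall x, G m (tds_map A x) = G m' x) ->
  (forall m, exists m', forall x, G m x = G m' (tds_map A x)) ->
  exists (Y : tds R) (pi : A -> Y), [/\ factor_map pi,
    forall x y, pi x = pi y <-> forall m, G m x = G m y
  & forall (B : set Y) x, open B -> B (pi x) ->
      exists M (e : R), 0 < e /\ forall y,
      (forall m, (m < M)%N -> `|G m x - G m y| < e) -> B (pi y)].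
Proof.
move=> cG GT GT'; have [cT [T' [cT' TK T'K]]] := tds_homeo A.
pose p := sepproj G.
have cp : continuous p by exact: sepproj_continuous.
have sp : p @` setT = setT by exact: sepproj_surj.
have cq : compact [set: sepquot G].
  rewrite -sp; apply: continuous_compact; last exact: tds_compact.
  exact: continuous_subspaceT.
pose S (u : sepquot G) := p (tds_map A (sval u)).
pose S' (u : sepquot G) := p (T' (sval u)).
have Gp x m : G m (sval (p x)) = G m x.
  by move: m; apply/sepproj_eq; rewrite sepprojK.
have Sp x : S (p x) = p (tds_map A x).
  apply/sepproj_eq => m; have [m' Hm] := GT m; by rewrite !Hm /= Gp.
have S'p x : S' (p x) = p (T' x).
  apply/sepproj_eq => m; have [m' Hm] := GT' m; by rewrite !Hm !T'K /= Gp.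
have cont (f : A -> A) (g : sepquot G -> sepquot G) : continuous f ->
    (forall x, g (p x) = p (f x)) -> continuous g.
  move=> cf gp; apply: (continuous_quotient (tds_compact (t := A)) _ cp sp).
    exact: sepquot_hausdorff.
  rewrite (_ : g \o p = p \o f); last by apply/funext => x /=; rewrite gp.
  by move=> x; apply: continuous_comp; [exact: cf|exact: cp].
have pK u : exists x, p x = u by exists (sval u); exact: sepprojK.
have hS : homeomorphism S.
  split; first exact: cont Sp.
  exists S'; split; first exact: cont S'p.
    by move=> u; have [x <-] := pK u; rewrite Sp S'p TK.
  by move=> u; have [x <-] := pK u; rewrite S'p Sp T'K.
exists (TDS cq (sepquot_metrizable G) hS), p; split.
- by split=> // x; rewrite -Sp.
- exact: sepproj_eq.
- by move=> B x; exact: sepproj_open.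
Qed.

(** * Dyadic codes of real numbers *)

Section Code.
Context {R : realType}.
Implicit Types (y z : R) (n N : nat).

(* [digit n] is [None] once the value [y] is already determined by the digits of
   lower rank, i.e. when [y] is a dyadic number of level [n - 1] (or [y = 1] for
   [n = 0]). *)
Definition special n y : Prop :=
  if n is m.+1 then exists k : nat, 2 ^+ m * y = k%:R else y = 1.

Definition digit n N y : option 'I_(2 ^ N).+1 :=
  if `[< special n y >] then None else Some (inord (Num.truncn (2 ^+ n * y))).

(** All ranks [n <= N] share the alphabet of rank [N], so that the code is a single finite function;
    by [truncn_digit], [inord] loses nothing. *)
Definition dyadic_code N y : {ffun 'I_N.+1 -> option 'I_(2 ^ N).+1} :=
  [ffun n : 'I_N.+1 => digit n N y].

(** Equality of digits freed from the alphabet, hence comparable between codes with different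
    [N]. *)
Definition same_digit n y z := (special n y <-> special n z) /\
  (~ special n y -> Num.truncn (2 ^+ n * y) = Num.truncn (2 ^+ n * z)).

Lemma truncn_digit n N y : (n <= N)%N -> 0 <= y <= 1 ->
  (Num.truncn (2 ^+ n * y) < (2 ^ N).+1)%N.
Proof.
move=> nN /andP[y0 y1]; rewrite ltnS -(ler_nat R).
have H : 0 <= 2 ^+ n * y by rewrite mulr_ge0// exprn_ge0.
have /andP[/le_trans + _] := truncn_itv H; apply.
rewrite natrX (@le_trans _ _ (2 ^+ n))//.
  by rewrite ler_piMr// exprn_ge0.
by rewrite ler_weXn2l// ler1n.
Qed.

Lemma digit_eqP n N y z : (n <= N)%N -> 0 <= y <= 1 -> 0 <= z <= 1 ->
  digit n N y = digit n N z <-> same_digit n y z.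
Proof.
move=> nN y01 z01; rewrite /digit /same_digit.
case: asboolP => sy; case: asboolP => sz.
- by split=> // _; split.
- by split=> // -[[/(_ sy)]].
- by split=> // -[[_ /(_ sz)]].
split=> [[/(congr1 (@nat_of_ord _))]|[_ H]]; last by rewrite (H sy).
by rewrite !inordK ?truncn_digit// => ->.
Qed.

Lemma dyadic_code_eqP N y z : 0 <= y <= 1 -> 0 <= z <= 1 ->
  dyadic_code N y = dyadic_code N z <-> forall n, (n <= N)%N -> same_digit n y z.
Proof.
move=> y01 z01; split=> [/ffunP yz n nN|yz].
  have := yz (Ordinal (nN : (n < N.+1)%N)); rewrite !ffunE /=.
  by move/digit_eqP; apply.
apply/ffunP => n; rewrite !ffunE; apply/digit_eqP => //; first by rewrite -ltnS.
by apply: yz; rewrite -ltnS.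
Qed.

Lemma dyadic_code_refine N y z : 0 <= y <= 1 -> 0 <= z <= 1 ->
  dyadic_code N.+1 y = dyadic_code N.+1 z -> dyadic_code N y = dyadic_code N z.
Proof.
move=> y01 z01 /dyadic_code_eqP yz; apply/dyadic_code_eqP => // n nN.
by apply: yz => //; rewrite ltnW.
Qed.

Lemma dist_trunc y z : 0 <= y -> 0 <= z -> Num.truncn y = Num.truncn z -> `|y - z| < 1.
Proof.
move=> y0 z0 yz; have := truncn_itv y0; have := truncn_itv z0.
by rewrite yz -natr1 ltr_norml; lra.
Qed.

(** If [y] is special at rank [N.+1], then [y] and [z] are multiples of [2 ^- N] and, by induction,
    less than [2 ^- N] apart, so they coincide. Otherwise the truncations at rank [N.+1] give the
    bound directly. *)
Lemma same_digit_close N y z : 0 <= y <= 1 -> 0 <= z <= 1 ->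
  (forall n, (n <= N)%N -> same_digit n y z) -> `|y - z| < 2 ^- N.
Proof.
move=> y01 z01.
have small n : ~ special n y -> same_digit n y z -> `|y - z| < 2 ^- n.
  move=> sy [_ /(_ sy)]/dist_trunc H.
  have /andP[y0 _] := y01; have /andP[z0 _] := z01.
  have := H _ _; rewrite !mulr_ge0 ?exprn_ge0// => /(_ isT isT).
  rewrite -mulrBr normrM ger0_norm ?exprn_ge0// mulrC -ltr_pdivlMr ?exprn_gt0//.
  by rewrite div1r.
elim: N => [|N IH] yz.
  have [sy|/small] := pselect (special 0 y); last by apply; exact: yz.
  have /(_ sy) sz := (yz 0%N (leqnn _)).1.1.
  by rewrite sy sz subrr normr0 invr_gt0 exprn_gt0.
have [sy|/small] := pselect (special N.+1 y); last by apply; exact: yz.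
have [k ky] := sy; have [l lz] := (yz N.+1 (leqnn _)).1.1 sy.
have /IH : forall n, (n <= N)%N -> same_digit n y z by move=> n nN; apply/yz/ltnW.
have N0 : 0 < 2 ^+ N :> R by rewrite exprn_gt0.
rewrite -div1r ltr_pdivlMr// -[X in _ * X](ger0_norm (ltW N0)) -normrM mulrBl.
rewrite ![_ * 2 ^+ N]mulrC ky lz => kl.
suff kE : k = l.
  have -> : y = z by apply: (mulfI (lt0r_neq0 N0)); rewrite ky lz kE.
  by rewrite subrr normr0 invr_gt0 exprn_gt0.
move: kl; rewrite ltr_norml => /andP[H1 H2].
have [H|H|//] := ltngtP k l.
  by move: H1; rewrite ltrBrDr addrC ltNge lerBrDr natr1 ler_nat H.
by move: H2; rewrite ltrBlDr addrC natr1 ltr_nat ltnS leqNgt H.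
Qed.

Lemma dyadic_code_close N y z : 0 <= y <= 1 -> 0 <= z <= 1 -> dyadic_code N y = dyadic_code N z ->
  `|y - z| < 2 ^- N.
Proof. by move=> y01 z01 /dyadic_code_eqP H; apply: same_digit_close => //; exact: H. Qed.

End Code.

(** * Functions of low entropy and the factors they generate *)

Section LowEntropy.
Context {R : realType} (X : topological_flow R).

(** Uniformity in [N] stands in for the entropy of the infinite code. *)
Definition low_entropy (c : R) (f : X -> R) : Prop :=
  [/\ continuous f, forall x, 0 <= f x <= 1,
    forall N, borel_partition (dyadic_code N \o f)
  & forall mu : probability (borel X) R, invariant_measure mu ->
    forall N, static_entropy mu (dyadic_code N \o f) <= c].

Lemma borel_special n (f : X -> R) : continuous f -> (forall x, 0 <= f x <= 1) ->
  measurable ([set x | special n (f x)] : set (borel X)).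
Proof. by case: n => [|n] cf f01; [exact: borel_eq|exact: borel_lattice]. Qed.

Lemma digit_partition n N (f : X -> R) : (n <= N)%N -> continuous f ->
  (forall x, 0 <= f x <= 1) -> borel_partition (digit n N \o f).
Proof.
move=> nN cf f01 [k|].
  rewrite (_ : _ @^-1` _ = ~` [set x | special n (f x)] `&`
      ([set x | k%:R <= 2 ^+ n * f x] `&` [set x | 2 ^+ n * f x < k.+1%:R])).
    have cnf : continuous (fun x => 2 ^+ n * f x).
      by move=> x; apply: cvgM; [exact: cvg_cst|exact: cf].
    apply: measurableI; first by apply: measurableC; exact: borel_special.
    by apply: measurableI; [exact: borel_le|exact: borel_lt].
  apply/seteqP; split=> x /=; rewrite /digit;
    have nf0 : 0 <= 2 ^+ n * f x by
      (have /andP[f0 _] := f01 x; rewrite mulr_ge0// exprn_ge0).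
    case: asboolP => // sx [/(congr1 (@nat_of_ord _))].
    rewrite inordK ?truncn_digit// => kx; split=> //; apply/andP.
    by rewrite -truncn_eq// kx.
  move=> [sx /andP]; rewrite -truncn_eq// => /eqP kx.
  by case: asboolP => // _; congr Some; rewrite kx inord_val.
rewrite (_ : _ @^-1` _ = [set x | special n (f x)]); first exact: borel_special.
by apply/seteqP; split=> x /=; rewrite /digit; case: asboolP.
Qed.

Lemma low_entropy_exists (w w' : X) (a c : R) : 0 < c -> flow X a w <> w -> w <> w' ->
  exists2 f, low_entropy c f & f w <> f w'.
Proof.
move=> c0 aw ww'.
have cn n : 0 < c / 2 ^+ n.+1 by rewrite divr_gt0// exprn_gt0.
have e_exists n := static_entropy_small (option 'I_(2 ^ n).+1) (cn n).
have /choice[e eP] : forall n, exists e, 0 < e /\ forall (Y : ptopologicalType)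
    (mu : probability (borel Y) R) (xi : Y -> option 'I_(2 ^ n).+1) i0,
    borel_partition xi -> prob mu (~` (xi @^-1` [set i0])) <= e ->
    static_entropy mu xi <= c / 2 ^+ n.+1.
  by move=> n; have [e e0 He] := e_exists n; exists e.
have [f [cf f01 fw fw' Hf]] := staircase (fun n => (eP n).1) aw ww'.
exists f; last by rewrite fw fw'; apply/eqP; rewrite eq_sym oner_eq0.
have mdigit n N : (n <= N)%N -> borel_partition (digit n N \o f).
  by move=> nN; exact: digit_partition.
have mcode N : borel_partition (dyadic_code N \o f).
  by apply: borel_partition_ffun => n; apply: mdigit; rewrite -ltnS.
split=> // mu imu N.
have [||_] := static_entropy_family mu (xi := fun n : 'I_N.+1 => digit n N \o f)
  (zeta := dyadic_code N \o f).
- by move=> n; apply: mdigit; rewrite -ltnS.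
- by move=> x y xy; apply/ffunP => n; rewrite !ffunE; exact: xy.
move=> /le_trans; apply.
apply: (@le_trans _ _ (\sum_(n < N.+1) c / 2 ^+ n.+1)).
  apply: ler_sum => n _; have nN : (n <= N)%N by rewrite -ltnS.
  (* Passing to the alphabet of rank [n] frees the threshold [e n] from [N]. *)
  apply: (le_trans (static_entropy_le mu (xi := digit n n \o f) _ _)).
  - exact: mdigit.
  - move=> x y /= /digit_eqP H; apply/digit_eqP => //; exact: H.
  apply: ((eP n).2 _ mu _ None); first exact: mdigit.
  have [H0 H] := Hf mu imu.
  rewrite (_ : _ @^-1` _ = [set x | special n (f x)]).
    by case: (nat_of_ord n).
  by apply/seteqP; split=> x /=; rewrite /digit; case: asboolP.
have -> : \sum_(n < N.+1) c / 2 ^+ n.+1 = c - c / 2 ^+ N.+1.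
  elim: N.+1 => [|M IH]; first by rewrite big_ord0 expr0 divr1 subrr.
  rewrite big_ord_recr /= IH exprS invfM; lra.
by rewrite gerBl ltW.
Qed.

End LowEntropy.

Section LowEntropyFactor.
Context {R : realType} (X : topological_flow R) (tau : R).

(** Pairs (function, time) are enumerated through [pickle]; numbers coding no pair, and indices
    [i >= n], give the constant 0, which separates nothing. Times range over [int] so that the
    family is stable under the time-[tau] map and its inverse. *)
Definition sample (g : nat -> X -> R) (n : nat) (m : nat) (x : X) : R :=
  if unpickle m is Some (i, z) then
    if (i < n)%N then g i (flow X ((z : int)%:~R * tau) x) else 0
  else 0.

Lemma sample_pickle g n i z x : (i < n)%N ->
  sample g n (pickle (i, z)) x = g i (flow X (z%:~R * tau) x).
Proof. by move=> iN; rewrite /sample pickleK iN. Qed.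

Lemma sample_continuous g n m : (forall i, continuous (g i)) -> continuous (sample g n m).
Proof.
move=> cg; rewrite /sample; case: (unpickle m) => [[i z]|]; last first.
  by move=> x; exact: cvg_cst.
case: (i < n)%N; last by move=> x; exact: cvg_cst.
have : continuous (g i \o flow X (z%:~R * tau)) by
  (move=> x; apply: continuous_comp; [exact: flow_cont|exact: cg]).
by [].
Qed.

Lemma sample_shift g n m (s : int) : exists m', forall x,
  sample g n m (flow X (s%:~R * tau) x) = sample g n m' x.
Proof.
unfold sample; case E : (unpickle m) => [[i z]|]; last by exists m => x; rewrite E.
exists (pickle (i, z + s)) => x; rewrite pickleK.
by case: ifP => // _; rewrite -flowD -mulrDl -rmorphD.
Qed.

Lemma low_entropy_factor (g : nat -> X -> R) (n : nat) (c : R) :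
  (forall i, low_entropy c (g i)) ->
  exists (Y : tds R) (pi : X -> Y), [/\ factor_map (A := flow_tds X tau) pi,
    forall x y, pi x = pi y <-> forall i (z : int), (i < n)%N ->
      g i (flow X (z%:~R * tau) x) = g i (flow X (z%:~R * tau) y)
  & (flow_entropy pi <= (n%:R * c)%:E)%E].
Proof.
move=> lg.
have cg i : continuous (g i) by have [] := lg i.
have g01 i x : 0 <= g i x <= 1 by have [_ + _ _] := lg i; apply.
have flowT x : flow X tau x = flow X ((1%:Z)%:~R * tau) x by rewrite mul1r.
have [||| Y [pi [fpi piE pi_open]]] :=
  @factor_of_functions R (flow_tds X tau) (sample g n).
- by move=> m; exact: sample_continuous.
- move=> m; have [m' Hm] := sample_shift g n m 1; exists m' => x.
  by rewrite -Hm /= flowT.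
- move=> m; have [m' Hm] := sample_shift g n m (- 1); exists m' => x.
  by rewrite -Hm /= flowT -flowD -mulrDl -rmorphD addNr mul0r flow0.
exists Y, pi; split=> //.
  move=> x y; rewrite piE; split=> [xy i z iN|xy m].
    by have := xy (pickle (i, z)); rewrite !sample_pickle.
  rewrite /sample; case: (unpickle m) => [[i z]|//].
  by case: ifP => // iN; exact: xy.
have [cpi spi piT] := fpi.
pose Q N (x : X) : {ffun 'I_n -> {ffun 'I_N.+1 -> option 'I_(2 ^ N).+1}} :=
  [ffun i : 'I_n => dyadic_code N (g i x)].
have mQ N : borel_partition (Q N).
  by apply: borel_partition_ffun => i; have [_ _ + _] := lg i; apply.
have Q_refine N x y : Q N.+1 x = Q N.+1 y -> Q N x = Q N y.
  move=> /ffunP xy; apply/ffunP => i; have := xy i; rewrite !ffunE.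
  exact: dyadic_code_refine.
apply: ge_ereal_sup => _ [mu imu <-].
apply: (@ks_entropy_le _ _ tau _ Q mQ Q_refine mu Y pi) => //.
  move=> N; have [||_] := static_entropy_family mu
    (xi := fun i : 'I_n => dyadic_code N \o g i) (zeta := Q N).
  - by move=> i; have [_ _ + _] := lg i; apply.
  - by move=> x y xy; apply/ffunP => i; rewrite !ffunE; exact: xy.
  move=> /le_trans; apply; apply: (@le_trans _ _ (\sum_(i < n) c)).
    by apply: ler_sum => i _; have [_ _ _ /(_ mu imu)] := lg i; apply.
  by rewrite sumr_const card_ord mulr_natl.
move=> B oB x Bx; have [M [e [e0 He]]] := pi_open B x oB Bx.
pose zabs m := if unpickle m is Some (i, z) then `|(i : nat, z : int).2|%N else 0%N.
have [N NM Ne] : exists2 N : nat, forall m, (m < M)%N -> (zabs m <= N)%N & 2 ^- N <= e.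
  (* One [N] has to make the window reach the times of the first [M] samples and the code precise to
     within [e]. *)
  exists (maxn (\max_(m < M) zabs m) (Num.truncn e^-1)).
    move=> m mM; rewrite leq_max; apply/orP; left.
    exact: (leq_bigmax (Ordinal mM)).
  set K := maxn _ _; rewrite -[leRHS]invrK lef_pV2 ?posrE ?invr_gt0 ?exprn_gt0//.
  rewrite (le_trans (ltW (truncnS_gt _)))// (@le_trans _ _ K.+1%:R) ?ler_nat//.
    by rewrite ltnS leq_maxr.
  by rewrite -natrX ler_nat ltn_expl.
exists N => y /windowP xy; apply: He => m mM.
have := NM m mM; rewrite /zabs /sample; case: (unpickle m) => [[i z]|] zN; last first.
  by rewrite subrr normr0.
case: ifP => iN; last by rewrite subrr normr0.
apply: lt_le_trans Ne; apply: dyadic_code_close => //.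
(* Time [z] sits at place [z + N] of the window. *)
have [k kN kz] : exists2 k : nat, (k <= N.*2)%N & k%:R - N%:R = z%:~R :> R.
  have zN' : (absz z <= N)%N by [].
  exists (absz ((z : int) + N%:Z)); first by lia.
  have -> : (absz ((z : int) + N%:Z))%:R = ((z : int) + N%:Z)%:~R :> R.
    by rewrite pmulrn; congr intmul; lia.
  by rewrite rmorphD /= addrK.
have := xy k kN; rewrite kz => /ffunP/(_ (Ordinal iN)).
by rewrite !ffunE.
Qed.

End LowEntropyFactor.

(** * Separating sequences and inverse limits *)

Lemma prod_continuous (I : eqType) (X : topologicalType) (K : I -> topologicalType)
    (F : X -> prod_topology K) :
  (forall i, continuous (fun x => F x i)) -> continuous F.
Proof.
move=> cF x; apply/cvg_sup => i; move: x.
apply/(@continuousP _ (initial_topology (@^~ i))) => A [B oB <-].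
rewrite (_ : _ @^-1` _ = (fun x => F x i) @^-1` B)//.
by apply: open_comp => // x _; exact: cF.
Qed.

Section Separating.
Context {R : realType} (X : topological_flow R).

Lemma metrizable_hausdorff (T : topologicalType) : metrizable R T -> hausdorff_space T.
Proof.
move=> [d [d0 dC dT dn]] x y xy; apply: contrapT => nxy.
have dge0 u v : 0 <= d u v.
  have := dT u v u; rewrite (proj2 (d0 u u) erefl) [d v u]dC; lra.
have dxy : 0 < d x y.
  by rewrite lt_neqAle dge0 andbT eq_sym; apply/eqP => /d0.
have e0 : 0 < d x y / 2 by rewrite divr_gt0.
have := xy [set z | d x z < d x y / 2] [set z | d y z < d x y / 2].
case; [by apply/dn; exists (d x y / 2)|by apply/dn; exists (d x y / 2)|].
move=> z /= [H1 H2]; have := dT x z y; rewrite [d z y]dC; lra.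
Qed.

Lemma not_fixed : fixed_point_free X -> forall x : X, exists a, flow X a x <> x.
Proof.
move=> fpf x; apply: contrapT => H; apply: (fpf x) => t.
by apply: contrapT => tx; apply: H; exists t.
Qed.

(** The complement of the diagonal is a countable union of compact sets [C m], and on each of them
    finitely many of the open conditions [F q x <> F q y] suffice. *)
Lemma separating_sequence (c : R) : fixed_point_free X -> 0 < c ->
  exists g : nat -> X -> R, (forall i, low_entropy c (g i)) /\
    forall x y, x <> y -> exists i, g i x <> g i y.
Proof.
move=> /not_fixed fpf c0.
have /choice[F FP] : forall p : X * X, exists f, low_entropy c f /\
    (p.1 <> p.2 -> f p.1 <> f p.2).
  move=> [x y]; have [xy|xy] := pselect (x = y); last first.
    have [a ax] := fpf x; have [f lf fxy] := low_entropy_exists c0 ax xy.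
    by exists f.
  (* On the diagonal any function of low entropy will do; the moved point [flow X a x] serves as the
     second point. *)
  have [a ax] := fpf x; have [f lf fxy] := low_entropy_exists c0 ax (fun E => ax (esym E)).
  by exists f; split.
have cF p : continuous (F p) by have [[]] := FP p.
have [d [d0 dC dT dn]] := flow_metrizable X.
have dge0 := dist_ge0 d0 dC dT.
pose C (m : nat) : set (X * X) := [set p | m.+1%:R^-1 <= d p.1 p.2].
have cd : continuous (fun p : X * X => d p.1 p.2).
  move=> p; apply/cvgrPdist_lt => e e0.
  have e20 : 0 < e / 2 by rewrite divr_gt0.
  exists ([set y | d p.1 y < e / 2], [set y | d p.2 y < e / 2]) => /=.
    by split; apply/dn; exists (e / 2).
  move=> [y z] /= [H1 H2].
  have := dT p.1 y p.2; have := dT y z p.2; have := dT y p.1 z; have := dT p.1 p.2 z.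
  rewrite [d z p.2]dC [d y p.1]dC ltr_norml; lra.
have cC m : compact (C m).
  apply: (@subclosed_compact _ _ setT) => //.
    apply: (@preimage_closed _ _ (fun p : X * X => d p.1 p.2) [set r | m.+1%:R^-1 <= r]).
      by move=> p _; exact: cd.
    exact: closed_ge.
  rewrite -setXTT; apply: compact_setX; exact: flow_compact.
have /choice[D HD] : forall m, exists D : seq (X * X), forall p, C m p ->
    exists2 q, q \in D & F q p.1 <> F q p.2.
  move=> m; have := cC m.
  pose XX : ptopologicalType := HB.pack (X * X)%type.
  rewrite (@compact_cover XX).
  move=> /(_ (X * X)%type setT (fun q => [set p | F q p.1 <> F q p.2]))[].
  - move=> q _; rewrite (_ : [set p | _] = (fun p : X * X => F q p.1 - F q p.2) @^-1` [set r | r != 0]).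
      apply: open_comp; last exact: open_neq.
      move=> p _; apply: cvgB.
        apply: (@continuous_comp _ _ _ fst (F q)); [exact: cvg_fst|exact: cF].
      apply: (@continuous_comp _ _ _ snd (F q)); [exact: cvg_snd|exact: cF].
    by apply/seteqP; split=> p /=; rewrite subr_eq0 => /eqP.
  - move=> p Cp; exists p => //=; have [_] := FP p; apply => E.
    by move: Cp; rewrite /C /= (proj2 (d0 _ _) E) leNgt invr_gt0 ltr0n.
  move=> D' _ HD; exists (finmap.enum_fset D') => p /HD[q /= qD qp]; exists q => //.
pose g k := if unpickle k is Some (m, i) then F (nth point (D m) i) else F point.
exists g; split.
  move=> k; rewrite /g; case: (unpickle k) => [[m i]|].
    by have [] := FP (nth point (D m) i).
  by have [] := FP point.
move=> x y xy.
have dxy : 0 < d x y by rewrite lt_neqAle dge0 andbT eq_sym; apply/eqP => /d0.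
have Cxy : C (Num.truncn (d x y)^-1) (x, y).
  rewrite /C /= -[leRHS]invrK lef_pV2 ?posrE ?invr_gt0//.
  exact: ltW (truncnS_gt _).
have [q qD qxy] := HD _ _ Cxy.
exists (pickle (Num.truncn (d x y)^-1, index q (D (Num.truncn (d x y)^-1)))).
by rewrite /g pickleK nth_index.
Qed.

End Separating.

Lemma inverse_limit_of_factors (R : realType) (A : tds R) (W : nat -> tds R)
    (pi : forall n, A -> W n) :
  (forall n, factor_map (pi n)) ->
  (forall n x y, pi n.+1 x = pi n.+1 y -> pi n x = pi n y) ->
  (forall x y, (forall n, pi n x = pi n y) -> x = y) ->
  exists q : forall n, W n.+1 -> W n, [/\ forall n, factor_map (q n),
    forall n, pi n = q n \o pi n.+1
  & isomorphism_onto_inverse_limit q (fun x n => pi n x)].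
Proof.
move=> fpi refine sep.
have cpi n : continuous (pi n) by have [] := fpi n.
have hW n : hausdorff_space (W n) := metrizable_hausdorff (tds_metrizable (W n)).
have pi_surj n (u : W n) : exists x, pi n x = u.
  have [_ spi _] := fpi n.
  have [x _ xu] : (pi n @` setT) u by rewrite spi.
  by exists x.
have piT n x : pi n (tds_map A x) = tds_map (W n) (pi n x) by have [] := fpi n.
(* By [refine] the value does not depend on the preimage chosen. *)
pose q n (u : W n.+1) : W n := pi n (projT1 (cid (pi_surj n.+1 u))).
have qpi n x : q n (pi n.+1 x) = pi n x.
  by apply: refine; exact: (projT2 (cid (pi_surj n.+1 (pi n.+1 x)))).
have q_pi n : pi n = q n \o pi n.+1 by apply/funext => x /=; rewrite qpi.
pose F (x : A) : prod_topology (fun n => W n : topologicalType) := fun n => pi n x.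
have cF : continuous F by apply: prod_continuous; exact: cpi.
have FI x y : F x = F y -> x = y.
  by move=> xy; apply: sep => n; exact: (congr1 (fun w => w n) xy).
have Frange : F @` setT = inverse_limit q.
  apply/seteqP; split=> [_ [x _ <-] n|w ww]; first exact: qpi.
  have /choice[s sP] : forall n, exists x, pi n x = w n by move=> n; exact: pi_surj.
  have wle n m x : (n <= m)%N -> pi m x = w m -> pi n x = w n.
    elim: m => [|m IH]; first by rewrite leqn0 => /eqP->.
    rewrite leq_eqVlt => /orP[/eqP->//|nm mx]; apply: IH => //.
    by rewrite -qpi mx; exact: ww.
  (* A cluster point of the partial solutions [s m] lies in every fibre [pi n x = w n], which is
     closed and contains [s m] for all [m >= n]. *)
  have [x [_ xs]] := tds_compact (t := A) (F := s @ \oo) _ filterT.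
  exists x => //; apply: functional_extensionality_dep => n.
  have cl : closed (pi n @^-1` [set w n]).
    move/continuous_closedP : (cpi n); apply.
    by apply: accessible_closed_set1; apply: hausdorff_accessible.
  apply: cl => B Bx; apply: xs => //.
  by exists n => // m /= nm; apply: wle nm (sP m).
exists q; split=> //.
  move=> n; split.
  - apply: (continuous_quotient (tds_compact (t := A)) _ (cpi n.+1)) => //.
      by have [] := fpi n.+1.
    by rewrite -q_pi; exact: cpi.
  - apply/seteqP; split=> // u _; have [x <-] := pi_surj n u.
    by exists (pi n.+1 x) => //; rewrite qpi.
  - by move=> u; have [x <-] := pi_surj _ u; rewrite -piT !qpi piT.
split=> //.
  (* Off the inverse limit [G] returns [point]; on it, continuity holds because [F] maps closed sets
     to closed sets. *)
  pose G (w : prod_topology (fun n => W n : topologicalType)) : A :=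
    xget point [set x | F x = w].
  have GK : cancel F G.
    by move=> x; rewrite /G; case: xgetP => [y _ /FI//|/(_ x) nx]; case: nx.
  exists G => //; apply/continuous_closedP => C clC; apply/closed_subspaceP.
  exists (F @` C).
    apply: compact_closed; first by apply: hausdorff_product => n; exact: hW.
    apply: continuous_compact; first exact: continuous_subspaceT.
    exact: subclosed_compact clC (tds_compact (t := A)) _.
  rewrite -Frange; apply/seteqP; split=> w [/= Cw [x _ xw]].
    by move: Cw => [y Cy yw]; split; [change (C (G w)); rewrite -yw (GK y)|exists x].
  by split; [exists x => //; rewrite -(GK x) xw|exists x].
by move=> x; apply: functional_extensionality_dep => n; exact: piT.
Qed.

Unset Implicit Arguments.
Set Strict Implicit.

Theorem theorem3 (R : realType) (X : topological_flow R) (hX : SFBP X)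
    (tau : R) :
  (forall delta : R, 0 < delta ->
   forall w w' : X, w <> w' ->
   exists (Y : tds R) (pi : X -> Y),
     [/\ factor_map (A := flow_tds X tau) pi,
         pi w <> pi w'
       & (flow_entropy pi < delta%:E)%E])
  /\
  (exists (W : nat -> tds R) (pi : forall n, X -> W n)
          (q : forall n, W n.+1 -> W n),
     [/\ forall n, factor_map (A := flow_tds X tau) (pi n),
         forall n, (flow_entropy (pi n) < +oo)%E,
         forall n, factor_map (q n),
         forall n, pi n = q n \o pi n.+1
       & isomorphism_onto_inverse_limit (A := flow_tds X tau) q
           (fun x n => pi n x)]).
Proof.
have [fpf _] := hX; split=> [delta delta0 w w' ww'|].
  have [a aw] := not_fixed fpf w.
  (* Half of [delta] makes the final inequality strict. *)
  have [f lf fw] := low_entropy_exists (divr_gt0 delta0 (ltr0n R 2)) aw ww'.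
  have [Y [pi [fpi piE hpi]]] := low_entropy_factor tau 1 (fun=> lf).
  exists Y, pi; split=> //.
    by move/piE => /(_ 0%N 0 isT); rewrite mul0r !flow0.
  by apply: le_lt_trans hpi _; rewrite lte_fin mul1r; lra.
have [g [lg gsep]] := separating_sequence fpf (@ltr01 R).
(* Level [n] uses [g 0] to [g n]: its entropy is at most [n.+1], and [g i] is available from level
   [i] on. *)
have /choice[W WP] := fun n => low_entropy_factor tau n.+1 lg.
pose pi n := projT1 (cid (WP n)).
have piP n := projT2 (cid (WP n)).
have fpi n : factor_map (A := flow_tds X tau) (pi n) by have [] := piP n.
have piE n x y := (let: And3 _ H _ := piP n in H) x y.
have [|| q [fq piq iso]] := @inverse_limit_of_factors R (flow_tds X tau) W pi fpi.
- by move=> n x y /piE xy; apply/piE => i z iN; apply: xy; rewrite ltnW.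
- move=> x y xy; apply: contrapT => /gsep[i]; apply.
  by have /piE /(_ i 0 (ltnSn i)) := xy i; rewrite mul0r !flow0.
exists W, pi, q; split=> // n.
by have [_ _ /le_lt_trans] := piP n; apply; rewrite ltry.
Qed.
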